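(* Let $\mathcal{M}$ be the stable-like process associated with $\beta$ and $\mu$ its occupation measure (see context). Let $\mathcal{E}=\{\beta(\mathcal{M}_t): t\in S(\mathcal{M}),\ \beta(\mathcal{M}_t)\ge 2\beta(\mathcal{M}_{t-})\}\cup\{2\beta(\mathcal{M}_{t-}): t\in S(\mathcal{M}),\ \beta(\mathcal{M}_t)\ge 2\beta(\mathcal{M}_{t-})\}$. With probability $1$, for every non-trivial open interval $\mathcal{O}\subset\mathbb{R}$ and every $h\in\mathcal{E}$, three cases may occur (with $t\in S(\mathcal{M})$ in each case). (1) $h=\beta(\mathcal{M}_t)>2\beta(\mathcal{M}_{t-})$. If $\mathcal{M}_t\notin\mathcal{O}$, then $\overline d_\mu(\mathcal{O},h)=-\infty$; otherwise $\overline d_\mu(\mathcal{O},h)=0$ if $\overline{\dim}(\mu,\mathcal{M}_t)=h$, and $\overline d_\mu(\mathcal{O},h)=-\infty$ if $\overline{\dim}(\mu,\mathcal{M}_t)>h$. (2) $h=2\beta(\mathcal{M}_{t-})<\beta(\mathcal{M}_t)$. If $\mathcal{M}_{t-}\notin\mathcal{O}$, then $\overline d_\mu(\mathcal{O},h)=-\infty$; otherwise $\overline d_\mu(\mathcal{O},h)=0$ if $\overline{\dim}(\mu,\mathcal{M}_{t-})=h$, and $\overline d_\mu(\mathcal{O},h)=-\infty$ if $\overline{\dim}(\mu,\mathcal{M}_{t-})<h$. (3) $h=\beta(\mathcal{M}_t)=2\beta(\mathcal{M}_{t-})$. If $\{\mathcal{M}_t,\mathcal{M}_{t-}\}\subset\mathcal{O}$,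 then $\overline d_\mu(\mathcal{O},h)=0$ if $\overline{\dim}(\mu,\mathcal{M}_{t-})=h$ or $\overline{\dim}(\mu,\mathcal{M}_t)=h$, and $\overline d_\mu(\mathcal{O},h)=-\infty$ if $\overline{\dim}(\mu,\mathcal{M}_{t-})<h$ and $\overline{\dim}(\mu,\mathcal{M}_t)>h$. If $\mathcal{M}_{t-}\in\mathcal{O}$ and $\mathcal{M}_t\notin\mathcal{O}$, then $\overline d_\mu(\mathcal{O},h)=0$ if $\overline{\dim}(\mu,\mathcal{M}_{t-})=h$, and $-\infty$ if $\overline{\dim}(\mu,\mathcal{M}_{t-})<h$. If $\mathcal{M}_t\in\mathcal{O}$ and $\mathcal{M}_{t-}\notin\mathcal{O}$, then $\overline d_\mu(\mathcal{O},h)=0$ if $\overline{\dim}(\mu,\mathcal{M}_{t})=h$, and $-\infty$ if $\overline{\dim}(\mu,\mathcal{M}_{t})>h$. If neither $\mathcal{M}_t$ nor $\mathcal{M}_{t-}$ belongs to $\mathcal{O}$, then $\overline d_\mu(\mathcal{O},h)=-\infty$.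
   Context: Fix $\varepsilon_0>0$ and let $\beta:\mathbb{R}\to[\varepsilon_0,1-\varepsilon_0]$ be a nowhere constant (not constant on any nontrivial interval), non-decreasing, Lipschitz continuous map. Let $N(dt,dz)$ be a Poisson random measure on $[0,\infty)\times(0,\infty)$ with intensity $dt\otimes dz/z^2$ and let $(\mathcal F_t)$ be its natural filtration. The stable-like process $\mathcal{M}$ associated with $\beta$ is the unique càdlàg $(\mathcal F_t)$-adapted solution of $\mathcal{M}_t=\int_0^t\int_0^1 z^{1/\beta(\mathcal{M}_{u-})}\,N(du,dz)$, $t\in[0,1]$; it is an increasing, pure jump, strong Markov process with generator $f\mapsto \int_0^1 (f(x+u)-f(x))\beta(x)u^{-1-\beta(x)}\,du$. $\mathcal{M}_{t-}$ denotes the left limit at $t$, and $S(\mathcal{M})$ the set of jump times of $\mathcal{M}$. Its occupation measure is $\mu(A)=\int_0^1 \mathbf 1_A(\mathcal{M}_t)\,dt$ for Borel $A\subset\mathbb{R}$. $\operatorname{Supp}(\mu)=\{x\in\mathbb{R}:\forall r>0,\ \mu(B(x,r))>0\}$. For $x\in\operatorname{Supp}(\mu)$, $\overline{\dim}(\mu,x)=\limsup_{r\downarrow0}\frac{\log\mu(B(x,r))}{\log r}$. With $\dim_{\mathcal H}$ the Hausdorff dimension and the convention $\dim_{\mathcal H}(\emptyset)=-\infty$, the space upper multifractal spectrum is, for $\mathcal{O}\subset\mathbb{R}$ open, $\overline{d}_\mu(\mathcal{O},h)=\dim_{\mathcal H}\{x\in\mathcal{O}\cap\operatorname{Supp}(\mu):\overline{\dim}(\mu,x)=h\}$.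 *)

(* Defs.v *)
From HB Require Import structures.
From mathcomp Require Import all_boot all_order all_algebra.
From mathcomp Require Import all_classical all_reals all_analysis.
From mathcomp Require Import measurable_realfun.

Set Implicit Arguments.
Unset Strict Implicit.
Unset Printing Implicit Defensive.

Import Order.TTheory GRing.Theory Num.Theory.
Import numFieldNormedType.Exports.

Local Open Scope classical_set_scope.
Local Open Scope ring_scope.

Section HausdorffDimension.
Context {R : realType}.
Implicit Types (A U : set R) (s delta : R).

Definition diameter U : \bar R :=
  ereal_sup [set `|p.1 - p.2|%:E | p in U `*` U].

(* Since 0 `^ 0 = 1, hausdorff_measure 0 is the counting measure; the empty set
   costs nothing for every s (its diameter, as defined above, is -oo). *)
Definition hausdorff_gauge s U : \bar R :=
  if U == set0 then 0%E else poweR (diameter U) s.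

Definition hausdorff_premeasure s delta A : \bar R :=
  ereal_inf [set (\sum_(0 <= i <oo) hausdorff_gauge s (U i))%E
    | U in [set U : nat -> set R |
        A `<=` \bigcup_i U i /\ forall i, (diameter (U i) <= delta%:E)%E]].

Definition hausdorff_measure s A : \bar R :=
  ereal_sup [set hausdorff_premeasure s delta A
    | delta in [set delta : R | 0 < delta]].

Definition hausdorff_dim A : \bar R :=
  if A == set0 then -oo%E
  else ereal_inf [set s%:E | s in [set s : R |
    0 <= s /\ hausdorff_measure s A = 0%E]].

End HausdorffDimension.

Section Multifractal.
Context {R : realType}.
Implicit Types (mu : set R -> \bar R) (x h : R) (O : set R).

Definition msupport mu : set R :=
  [set x | forall r : R, 0 < r -> (0 < mu (ball x r))%E].

(* Meaningful only for finite mu and x in msupport mu, where ln is applied to a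
   positive real; elsewhere ln 0 = 0 makes the value a convention. *)
Definition upper_local_dim mu x : \bar R :=
  limf_esup (fun r : R => (ln (fine (mu (ball x r))) / ln r)%:E) (0 : R)^'+.

Definition upper_spectrum mu O h : \bar R :=
  hausdorff_dim (O `&` msupport mu `&`
                 [set x | upper_local_dim mu x = h%:E]).

End Multifractal.

Section Paths.
Context {R : realType}.
Implicit Types (beta X : R -> R) (t : R).

(* Time runs over [0, 1]: only the restriction of a path to [0, 1] matters. *)
Definition cadlag X : Prop :=
  (forall t, 0 <= t < 1 -> X s @[s --> t^'+] --> X t) /\
  (forall t, 0 < t <= 1 -> cvg (X s @[s --> t^'-])).

Definition left_limit X t : R := lim (X s @[s --> t^'-]).

Definition jump_times X : set R :=
  [set t | 0 < t <= 1 /\ X t != left_limit X t].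

Definition occupation_measure X (A : set R) : \bar R :=
  (\int[lebesgue_measure]_(t in `[0%R, 1%R]) (\1_A (X t))%:E)%E.

Definition double_jump_times beta X : set R :=
  [set t | jump_times X t /\ 2 * beta (left_limit X t) <= beta (X t)].

Definition exceptional_values beta X : set R :=
  [set beta (X t) | t in double_jump_times beta X] `|`
  [set 2 * beta (left_limit X t) | t in double_jump_times beta X].

Definition nowhere_constant beta : Prop :=
  forall a b : R, a < b ->
    ~ exists c : R, forall x, a < x < b -> beta x = c.

End Paths.

Section PoissonRandomMeasure.
Context {R : realType} {d : measure_display} {Omega : measurableType d}.
Variable P : probability Omega R.
Implicit Type N : R.-ker Omega ~> (R * R)%type.

Definition time_mark_space : set (R * R) := `[0%R, +oo[ `*` `]0%R, +oo[.

Definition time_mark_space_upto (t : R) : set (R * R) :=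
  `[0%R, t] `*` `]0%R, +oo[.

(* The measure dt (x) dz / z^2 on [0, +oo[ x ]0, +oo[. *)
Definition intensity (A : set (R * R)) : \bar R :=
  (\int[lebesgue_measure \x lebesgue_measure]_(p in A `&` time_mark_space)
     ((p.2 ^+ 2)^-1)%:E)%E.

Definition mutually_independent n (Y : 'I_n -> Omega -> \bar R) : Prop :=
  forall B : 'I_n -> set (\bar R), (forall i, measurable (B i)) ->
    P (\bigcap_(i in [set: 'I_n]) (Y i @^-1` B i)) =
    (\prod_(i < n) P (Y i @^-1` B i))%E.

(* A random measure on [0, +oo[ x ]0, +oo[ is seen as a kernel to R * R carried
   by that set.  The law of N A is given by poisson_prob, which unlike
   poisson_pmf is correct at rate 0; its second argument plays no role. *)
Definition poisson_random_measure N : Prop :=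
  [/\ forall w, N w (~` time_mark_space) = 0%E,
      forall w A, measurable A ->
        N w A = +oo%E \/ exists n : nat, N w A = (n%:R)%:E,
      forall A, measurable A -> (intensity A < +oo)%E -> forall k : nat,
        P [set w | N w A = (k%:R)%:E] =
        poisson_prob (fine (intensity A)) 0%N [set k],
      forall A, measurable A -> intensity A = +oo%E ->
        P [set w | N w A = +oo%E] = 1%E
    & forall n (A : 'I_n -> set (R * R)), (forall i, measurable (A i)) ->
        trivIset setT A ->
        mutually_independent (fun i w => N w (A i))].

Definition natural_filtration N (t : R) : set (set Omega) :=
  <<s [set E | exists (A : set (R * R)) (B : set (\bar R)),
       [/\ measurable A, A `<=` time_mark_space_upto t, measurable B
         & E = [set w | B (N w A)]]] >>.

Definition adapted N (M : R -> Omega -> R) : Prop :=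
  forall t, 0 <= t <= 1 -> forall B : set R, measurable B ->
    natural_filtration N t (M t @^-1` B).

Definition stable_like_process (beta : R -> R) N (M : R -> Omega -> R) : Prop :=
  adapted N M /\
  {ae P, forall w, cadlag (M ^~ w) /\
    forall t, 0 <= t <= 1 ->
      (M t w)%:E =
      (\int[N w]_(p in `]0%R, t] `*` `]0%R, 1%R])
         (p.2 `^ (beta (left_limit (M ^~ w) p.1))^-1)%:E)%E}.

End PoissonRandomMeasure.

(* Main.v *)
(**
Almost surely a jump time [t] with [2 beta(X_{t-}) <= beta(X_t)] separates the
upper local dimensions of the occupation measure: writing [L = X_{t-}], points
of the support below [L] have dimension [< 2 beta(L)], [L] itself has dimension
[<= 2 beta(L)], the gap between [L] and [X_t] carries no mass, [X_t] has
dimension [>= beta(X_t)] and points above have dimension [> beta(X_t)].  So a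
level [h] between [2 beta(L)] and [beta(X_t)] can be attained at [L] and [X_t]
only.

Lower bound.  By Borel-Cantelli, for [g > 1] and [n] large every time window of
length [e^-n] contains an atom of mark [> e^(-g n)], so [X] moves there by at
least [e^(-g n / b)] when [beta >= b].  Hence a ball of radius
[e^(-1 - g n / b)] is occupied for a time at most [4 e^-n].

Upper bound, for [b < 1/2].  For [g < 1/2] and [n] large no window of length
[3 e^-n] contains two atoms of mark [> e^(-g n)].  Hence every time has such an
atom-free window of length [e^-n] on its left or on its right.  There [X] moves
by at most a constant times [e^(-g n / b)]: for [g2 < 1] each window has a
bounded number of atoms of mark [> e^(-g2 n)], and all the jumps on [[0, 1]]
with marks below [e^(-g2 n)] together amount to [O(e^(-(g2 / b - 1) n))], so
that [g2 = g + b < 1] suffices.  So balls of radius of order [e^(-g n / b)]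
around the support are occupied for a time at least [e^-n].
*)
Require Import Defs.
From mathcomp Require Import all_boot all_order all_algebra.
From mathcomp Require Import all_classical all_reals all_analysis.
From mathcomp Require Import measurable_realfun.
From mathcomp Require Import ring lra.

Set Implicit Arguments.
Unset Strict Implicit.
Unset Printing Implicit Defensive.

Import Order.TTheory GRing.Theory Num.Theory.
Import numFieldNormedType.Exports.

Local Open Scope classical_set_scope.
Local Open Scope ring_scope.

(* Needs no measurability: the monotonicity of the path has to be known before
   the integrand defining it can be shown measurable. *)
Lemma integral_mono_patch d (T : measurableType d) (R : realType)
    (m : {measure set T -> \bar R}) (D E : set T) (f g : T -> \bar R) :
  (forall x, D x -> (0 <= f x)%E) -> (forall x, E x -> (0 <= g x)%E) ->
  (forall x, D x -> (f x != 0)%E -> E x /\ (f x <= g x)%E) ->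
  (\int[m]_(x in D) f x <= \int[m]_(x in E) g x)%E.
Proof.
move=> f0 g0 fg; rewrite !ge0_integralE//.
apply: ereal_sup_le => _ [h /= hf <-]; exists h => //= x.
apply: (le_trans (hf x)); rewrite /patch.
have gp : (0 <= (if x \in E then g x else 0))%E.
  by case: ifPn => // /set_mem/g0.
case: ifPn => // /set_mem Dx.
have [-> //|fx0] := eqVneq (f x) 0%E.
by have [/mem_set -> fgx] := fg x Dx fx0.
Qed.

(** * Hausdorff and local dimensions *)

Section Hausdorff.
Context {R : realType}.
Implicit Types (A : set R) (s x y : R).

Lemma diameter_set1 x : diameter [set x] = 0%E.
Proof.
rewrite /diameter (_ : [set _ | p in _] = [set 0%E]) ?ereal_sup1//.
apply/seteqP; split => [_ [[p1 p2] [/= -> ->] <-]|_ ->]; first by rewrite subrr normr0.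
by exists (x, x) => //=; rewrite subrr normr0.
Qed.

Lemma hausdorff_gauge_ge0 s A : (0 <= hausdorff_gauge s A)%E.
Proof. by rewrite /hausdorff_gauge; case: ifP => // _; exact: poweR_ge0. Qed.

(** Singletons have diameter 0 and cost nothing for any s > 0. At s = 0 the measure counts points,
    so the infimum 0 is only approached. *)
Lemma hausdorff_dim_pair A x y :
  A !=set0 -> A `<=` [set x; y] -> hausdorff_dim A = 0%E.
Proof.
move=> A0 Axy; rewrite /hausdorff_dim ifF; last exact/negbTE/set0P.
have H0 s : 0 < s -> hausdorff_measure s A = 0%E.
  move=> s0; rewrite /hausdorff_measure.
  suff pm0 delta : 0 < delta -> hausdorff_premeasure s delta A = 0%E.
    rewrite (_ : [set _ | _ in _] = [set 0%E]) ?ereal_sup1//.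
    apply/seteqP; split => [_ [e /= e0 <-]|_ ->]; first exact: pm0.
    by exists 1; [exact: ltr01|exact/pm0/ltr01].
  move=> delta0; apply/eqP; rewrite eq_le; apply/andP; split.
    apply: ereal_inf_lbound => /=.
    (* Covers are infinite sequences; repeating [[set y]] forever is free, since 0 to the power s
       vanishes for s > 0. *)
    exists (fun i => if i is 0%N then [set x] else [set y]).
      split => [z /Axy[->|->]|[|i]]; [by exists 0%N|by exists 1%N|..];
        by rewrite diameter_set1 lee_fin ltW.
    rewrite eseries0// => i _ _; rewrite /hausdorff_gauge.
    rewrite ifF; last by apply/negbTE/set0P; case: i => [|i]; [exists x|exists y].
    by case: i => [|i]; rewrite diameter_set1 poweR0r// gt_eqF.
  apply: le_ereal_inf_tmp => _ [U _ <-]; apply: nneseries_ge0 => n _ _.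
  exact: hausdorff_gauge_ge0.
apply/eqP; rewrite eq_le; apply/andP; split; last first.
  by apply: le_ereal_inf_tmp => _ [s [s0 _] <-]; rewrite lee_fin.
apply/lee_addgt0Pr => e e0; rewrite add0e; apply: ereal_inf_lbound.
by exists e => //=; split; [exact: ltW|exact: H0].
Qed.

End Hausdorff.

Section LocalDimension.
Context {R : realType}.
Implicit Types (f : R -> \bar R) (L : \bar R) (x : R) (m : set R -> \bar R).

Lemma limf_esup_at_right_le f L :
  (\forall r \near (0 : R)^'+, (f r <= L)%E) ->
  (limf_esup f (0 : R)^'+ <= L)%E.
Proof.
move=> fL; apply: ge_ereal_inf; exists (ereal_sup (f @` [set r | (f r <= L)%E])).
  by exists [set r | (f r <= L)%E].
by apply: ge_ereal_sup => _ [r /= ? <-].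
Qed.

Lemma limf_esup_at_right_ge f L :
  (forall e : R, 0 < e -> exists2 r, 0 < r < e & (L <= f r)%E) ->
  (L <= limf_esup f (0 : R)^'+)%E.
Proof.
move=> fL; apply: le_ereal_inf_tmp => _ [A A0 <-].
have [e /= e0 eA] : nbhs (0 : R)^'+ A by [].
have [r /andP[r0 re] Lr] := fL e e0.
apply: (le_trans Lr); apply: ereal_sup_ubound; exists r => //.
by apply: eA => //=; rewrite sub0r normrN gtr0_norm.
Qed.

(** Small balls have mass 0, and the convention [ln 0 = 0] makes the quotient vanish near 0. *)
Lemma upper_local_dim_notin_support m x :
  (forall A B, A `<=` B -> (m A <= m B)%E) -> (forall A, (0 <= m A)%E) ->
  ~ msupport m x -> upper_local_dim m x = 0%E.
Proof.
move=> mm m0 /existsNP[r /not_implyP[r0 /negP]]; rewrite -leNgt => mr.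
have f0 : \forall s \near (0 : R)^'+, (ln (fine (m (ball x s))) / ln s)%:E = 0%E.
  near=> s.
  have -> : m (ball x s) = 0%E.
    apply/eqP; rewrite eq_le m0 andbT (le_trans _ mr)//; apply: mm.
    apply: le_ball; near: s; exact: nbhs_right_le.
  by rewrite /= ln0// mul0r.
apply/eqP; rewrite eq_le; apply/andP; split.
  by apply: limf_esup_at_right_le; apply: filterS f0 => s ->.
apply: limf_esup_at_right_ge => e e0.
have [d /= d0 df] := f0.
exists (Num.min (e / 2) (d / 2)).
  by rewrite lt_min !divr_gt0//= gt_min ltr_pdivrMr// ltr_pMr// ltr1n.
rewrite df//=; last by rewrite lt_min !divr_gt0.
rewrite sub0r normrN gtr0_norm; last by rewrite lt_min !divr_gt0.
by rewrite gt_min orbC ltr_pdivrMr// ltr_pMr// ltr1n.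
Unshelve. all: by end_near. Qed.

(** A radius r is compared with the next smaller e^(k - a n). This changes n by at most 1, an error
    which, like k, disappears after division by - ln r. *)
Lemma upper_local_dim_le m x (k a : R) (n0 : nat) :
  (forall A B, A `<=` B -> (m A <= m B)%E) -> (forall A, (m A < +oo)%E) ->
  0 < a ->
  (forall n, (n0 <= n)%N ->
    ((expR (- n%:R))%:E <= m (ball x (expR (k - a * n%:R))))%E) ->
  (upper_local_dim m x <= a^-1%:E)%E.
Proof.
move=> mm moo a0 mn; apply/lee_addgt0Pr => e e0.
apply: limf_esup_at_right_le; near=> r.
have r0 : 0 < r by near: r; exact: nbhs_right_gt.
have near_ln (c : R) : (r <= expR (- c)) -> c <= - ln r.
  by move=> rc; rewrite lerNr -[leRHS]expRK ler_ln ?posrE ?expR_gt0.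
(* With [l = - ln r], the three thresholds give in turn l + k > 0, n >= n0 for the n chosen below,
   and an error |k| / a + 1 of at most e l. *)
have ln1 : `|k| + 1 <= - ln r.
  by apply: near_ln; near: r; apply: nbhs_right_le; exact: expR_gt0.
have ln2 : a * n0%:R - k <= - ln r.
  by apply: near_ln; near: r; apply: nbhs_right_le; exact: expR_gt0.
have ln3 : (`|k| / a + 1) / e <= - ln r.
  by apply: near_ln; near: r; apply: nbhs_right_le; exact: expR_gt0.
move: ln1 ln2 ln3; set l := - ln r => ln1 ln2 ln3.
have [kl kl'] : k <= `|k| /\ - k <= `|k|.
  by split; [exact: ler_norm|rewrite -normrN; exact: ler_norm].
have l0 : 0 < l by apply: lt_le_trans ln1; rewrite ltr_wpDl.
have lk0 : 0 <= (l + k) / a by apply: divr_ge0; [lra|exact: ltW].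
pose n := (Num.truncn ((l + k) / a)).+1.
have [n1 n2] : n%:R <= (l + k) / a + 1 /\ (l + k) / a < n%:R.
  have /andP[h1 h2] := truncn_itv lk0; split => //.
  by rewrite /n -natr1 lerD2r.
have n0n : (n0 <= n)%N.
  rewrite -(ler_nat R) (le_trans _ (ltW n2))// ler_pdivlMr// mulrC; lra.
have mr : ((expR (- n%:R))%:E <= m (ball x r))%E.
  apply: (le_trans (mn n n0n)); apply: mm; apply: le_ball.
  rewrite -[leRHS]lnK ?posrE// ler_expR.
  by move: n2; rewrite ltr_pdivrMr// /l => h; lra.
have mfin : m (ball x r) \is a fin_num.
  by rewrite ge0_fin_numE ?moo// (le_trans _ mr)// lee_fin expR_ge0.
move: mr; rewrite -(fineK mfin) lee_fin => mr.
have lnm : - n%:R <= ln (fine (m (ball x r))).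
  by rewrite -[leLHS]expRK ler_ln ?posrE ?expR_gt0// (lt_le_trans _ mr)// expR_gt0.
rewrite -EFinD lee_fin /=.
have -> : ln r = - l by rewrite /l opprK.
rewrite invrN mulrN -mulNr ler_pdivrMr//.
have : (`|k| / a + 1) <= l * e by rewrite -ler_pdivrMr.
have : k / a <= `|k| / a by rewrite ler_pM2r// invr_gt0.
rewrite mulrDl in n1.
rewrite mulrDl [a^-1 * l]mulrC [e * l]mulrC.
lra.
Unshelve. all: by end_near. Qed.

(** A limsup is bounded below along a single sequence of radii. Positive masses keep [ln] away from
    its conventional value at 0. *)
Lemma upper_local_dim_ge m x (k C a : R) (n0 : nat) :
  (forall A, (m A < +oo)%E) ->
  0 < a -> 0 < C ->
  (forall n, (n0 <= n)%N ->
    (0 < m (ball x (expR (k - a * n%:R))) <= (C * expR (- n%:R))%:E)%E) ->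
  (a^-1%:E <= upper_local_dim m x)%E.
Proof.
move=> moo a0 C0 mn; apply/lee_subgt0Pr => e e0.
rewrite -EFinB; apply: limf_esup_at_right_ge => d d0.
(* Beyond the first summand the radius is below d, beyond the second it is below 1, so that its
   logarithm is negative, and beyond the third the constants C and k are absorbed by e. *)
pose B := `|k - ln d| / a + `|k| / a + `|(ln C - (a^-1 - e) * k) / (e * a)|.
have ea : 0 < e * a by exact: mulr_gt0.
pose n := (maxn n0 (Num.truncn B).+1).
have Bn : B < n%:R.
  by apply: (lt_le_trans (truncnS_gt B)); rewrite ler_nat leq_maxr.
have [b1 b2 b3] : [/\ k - ln d < a * n%:R, k < a * n%:R &
   ln C - (a^-1 - e) * k < e * a * n%:R].
  have h1 : 0 <= `|k - ln d| / a by rewrite divr_ge0// ltW.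
  have h2 : 0 <= `|k| / a by rewrite divr_ge0// ltW.
  have h3 := normr_ge0 ((ln C - (a^-1 - e) * k) / (e * a)).
  split.
  - have : `|k - ln d| / a < n%:R by move: Bn; rewrite /B; lra.
    by rewrite ltr_pdivrMr// mulrC; apply: le_lt_trans; exact: ler_norm.
  - have : `|k| / a < n%:R by move: Bn; rewrite /B; lra.
    by rewrite ltr_pdivrMr// mulrC; apply: le_lt_trans; exact: ler_norm.
  - have : (ln C - (a^-1 - e) * k) / (e * a) < n%:R.
      apply: le_lt_trans Bn; rewrite /B.
      by have := ler_norm ((ln C - (a^-1 - e) * k) / (e * a)); lra.
    by rewrite ltr_pdivrMr// => h; lra.
exists (expR (k - a * n%:R)).
  rewrite expR_gt0/= -[ltRHS]lnK ?posrE// ltr_expR; lra.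
have /andP[m0 mC] := mn n (leq_maxl _ _).
have mfin : m (ball x (expR (k - a * n%:R))) \is a fin_num.
  by rewrite ge0_fin_numE ?moo// ltW.
move: m0 mC; rewrite -(fineK mfin) !lte_fin !lee_fin expRK => m0 mC.
have lnm : ln (fine (m (ball x (expR (k - a * n%:R))))) <= ln C - n%:R.
  have -> : ln C - n%:R = ln (C * expR (- n%:R)).
    by rewrite lnM ?posrE ?expR_gt0// expRK.
  by rewrite ler_ln ?posrE// mulr_gt0 ?expR_gt0.
rewrite /=; move: lnm; set F := ln (fine _) => lnm.
have -> : k - a * n%:R = - (a * n%:R - k) by rewrite opprB.
rewrite invrN mulrN -mulNr ler_pdivlMr ?subr_gt0//.
have -> : (a^-1 - e) * (a * n%:R - k) = n%:R - e * a * n%:R - (a^-1 - e) * k.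
  by field; rewrite gt_eqF.
lra.
Qed.

End LocalDimension.

(** * Poisson estimates *)

(** Half-open, so that adjacent windows of time or of marks are disjoint. Marks above 1 do not enter
    the equation of the path. *)
Definition band {R : realType} (a b c : R) : set (R * R) := `]a, b] `*` `]c, 1].

Lemma measurable_band {R : realType} (a b c : R) : measurable (band a b c).
Proof. exact: measurableX. Qed.

Section Intensity.
Context {R : realType}.
Local Notation leb := (@lebesgue_measure R).

Lemma within_continuous_invX2 (c : R) : 0 < c ->
  {within `[c, 1], continuous (fun z : R => (z ^+ 2)^-1)}.
Proof.
move=> c0; apply: continuous_in_subspaceT => z /set_mem /=.
rewrite in_itv/= => /andP[cz _]; apply: cvgV; last exact: exprn_continuous.
by rewrite expf_neq0// gt_eqF// (lt_le_trans c0).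
Qed.

Lemma measurable_invX2 (c : R) : 0 < c ->
  measurable_fun `]c, 1] (fun z : R => (z ^+ 2)^-1).
Proof.
move=> c0; apply: (@measurable_funS _ _ _ _ `[c, 1]) => //.
  exact: subset_itv_oc_cc.
by apply: subspace_continuous_measurable_fun => //; exact: within_continuous_invX2.
Qed.

Lemma integral_invX2 (c : R) : 0 < c -> c <= 1 ->
  (\int[leb]_(z in `]c, 1%R]) ((z ^+ 2)^-1)%:E = (c^-1 - 1)%:E)%E.
Proof.
move=> c0; rewrite le_eqVlt => /predU1P[->|c1].
  by rewrite set_itv_ge ?bnd_simp ?ltxx// integral_set0 invr1 subrr.
have dV (z : R) : z != 0 -> derivable (fun y : R => - y^-1) z 1.
  by move=> z0; apply: derivableN; exact: derivableV.
rewrite integral_itv_obnd_cbnd; last first.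
  by apply/measurable_EFinP; exact: measurable_invX2.
rewrite (@continuous_FTC2 _ _ (fun z : R => - z^-1))//; last 3 first.
- exact: within_continuous_invX2.
- split.
  + move=> z; rewrite in_itv/= => /andP[cz _]; apply: dV.
    by rewrite gt_eqF// (lt_trans c0).
  + apply: cvg_at_right_filter; apply: cvgN; apply: cvgV; rewrite ?gt_eqF//.
  + apply: cvg_at_left_filter; apply: cvgN; apply: cvgV; rewrite ?gt_eqF//.
- move=> z; rewrite in_itv/= => /andP[cz _].
  have z0 : z != 0 by rewrite gt_eqF// (lt_trans c0).
  rewrite derive1E deriveN; last exact: derivableV.
  rewrite (@deriveV _ _ (fun y : R => y)) ?derive_id; last 2 first.
  - exact: z0.
  - exact: derivable_id.
  by rewrite scaleNr opprK /GRing.scale/= mulr1.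
by rewrite -EFinB invr1 opprK addrC.
Qed.

Lemma intensity_band (a b c : R) : 0 <= a -> a <= b -> 0 < c -> c <= 1 ->
  intensity (band a b c) = ((b - a) * (c^-1 - 1))%:E.
Proof.
move=> a0 ab c0 c1; rewrite /intensity setIidl; last first.
  move=> [x z] [/=]; rewrite /time_mark_space /= !in_itv/= !andbT.
  by move=> /andP[ax _] /andP[cz _]; rewrite (le_trans a0 (ltW ax)) (lt_trans c0 cz).
have g0 (z : R) : 0 <= (z ^+ 2)^-1 by rewrite invr_ge0 sqr_ge0.
have mg := measurable_invX2 c0.
rewrite integral_mkcond fubini_tonelli1//=.
- rewrite /fubini_F (_ : (fun x => _) = fun x => ((c^-1 - 1)%:E * (\1_(`]a, b]) x)%:E)%E).
    rewrite ge0_integralZl_EFin//.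
    + rewrite integral_indic // setIT.
      rewrite [X in (_ * X)%E](_ : _ = (b - a)%:E); first by rewrite -EFinM mulrC.
      rewrite -[LHS]/(lebesgue_measure (`]a, b] : set R)) lebesgue_measure_itv/= lte_fin.
      case: ltP => [_|ba]; first by rewrite EFinB.
      by rewrite (_ : b - a = 0)//; apply/eqP; rewrite subr_eq0 eq_le ba.
    + by apply/measurable_EFinP; exact: measurable_indic.
    + by rewrite subr_ge0 invf_ge1.
  apply/funext => x; rewrite indicE; have [xab|xab] := boolP (x \in _).
    rewrite mule1 -integral_invX2// [RHS]integral_mkcond; apply: eq_integral => z _.
    rewrite !patchE; congr (if _ then _ else _).
    by apply/idP/idP => [/set_mem[]|zc] /=; rewrite ?inE//; split => //; apply/set_mem.
  rewrite mule0 integral0_eq// => z _; rewrite patchE ifF//.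
  by apply/negbTE; apply: contra xab => /set_mem[/= ? _]; exact/mem_set.
- apply/(measurable_restrictT _ _).1; first exact: measurable_band.
  apply/measurable_EFinP.
  apply: (@measurable_comp _ _ _ _ _ _ (`]c, 1] : set R) (fun z : R => (z ^+ 2)^-1)) => //.
  by move=> _ [[x z] [_ ?] <-].
  by apply: measurable_funS (@measurable_snd _ _ _ _).
- by move=> x; rewrite patchE; case: ifP => //= _; rewrite lee_fin.
Qed.

End Intensity.

Section PoissonTails.
Context {R : realType}.
Implicit Type l : R.
Local Open Scope ereal_scope.

Lemma poisson_prob0 l k : (0 <= l)%R -> poisson_prob l k [set 0%N] = (expR (- l))%:E.
Proof.
rewrite le_eqVlt /poisson_prob => /predU1P[<-|l0].
  by rewrite ltxx diracE mem_set// oppr0 expR0.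
by rewrite l0 esum_set1 ?lee_fin ?poisson_pmf_ge0// /poisson_pmf l0 expr0 fact0 invr1 !mul1r.
Qed.

(** Since (n + K)! >= n!, the weight of n + K is at most l^K times the weight of n, and the weights
    sum to 1. *)
Lemma poisson_prob_tail l k K : (0 <= l)%R -> (0 < K)%N ->
  poisson_prob l k [set n | (K <= n)%N] <= (l ^+ K)%:E.
Proof.
move=> l0 K0; rewrite /poisson_prob; case: ifPn => [lgt0|_]; last first.
  by rewrite diracE memNset/= ?lee_fin ?exprn_ge0//; case: K K0.
have p0 n : 0 <= (poisson_pmf l n)%:E by rewrite lee_fin poisson_pmf_ge0.
have lK0 : (0 <= l ^+ K)%R by rewrite exprn_ge0.
rewrite (_ : [set n | (K <= n)%N] = (addn^~ K) @` [set: nat]); last first.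
  apply/seteqP; split => [n /= Kn|_ [n _ <-]/=]; last by rewrite leq_addl.
  by exists (n - K)%N => //; rewrite subnK.
rewrite esum_image//; last by move=> a b _ _ /addIn.
have -> : (l ^+ K)%:E = \esum_(n in [set: nat]) ((l ^+ K)%:E * (poisson_pmf l n)%:E).
  rewrite -nneseries_esumT; last by move=> *; rewrite mule_ge0.
  rewrite nneseriesZl; last by move=> *; exact: p0.
  have : poisson_prob l k setT = 1 by exact: probability_setT.
  by rewrite /poisson_prob lgt0 => h; rewrite nneseries_esumT// h mule1.
apply: le_esum => n _; rewrite -EFinM lee_fin /poisson_pmf lgt0.
rewrite !mulrA ler_pM2r ?expR_gt0// exprD [(l ^+ n * _)%R]mulrC.
rewrite ler_wpM2l ?mulr_ge0 ?exprn_ge0//; try exact: ltW.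
by rewrite lef_pV2 ?posrE ?ltr0n ?fact_gt0// ler_nat leq_fact// leq_addr.
Qed.

End PoissonTails.

Lemma nneseries_geometric {R : realType} (C q : R) : 0 <= q -> q < 1 ->
  (\sum_(n <oo) (C * q ^+ n)%:E = (C * (1 - q)^-1)%:E)%E.
Proof.
move=> q0 q1; have := @cvg_geometric_series R C q.
rewrite ger0_norm// => /(_ q1) h.
apply/cvg_lim => //; apply/fine_cvgP; split; first by near=> n; rewrite sumEFin.
apply: cvg_trans h; apply: near_eq_cvg; near=> n.
by rewrite /= sumEFin /series /geometric /=.
Unshelve. all: by end_near. Qed.

Section PoissonMeasure.
Context {R : realType} {d : measure_display} {Omega : measurableType d}.
Variables (P : probability Omega R) (N : R.-ker Omega ~> (R * R)%type).
Hypothesis NP : poisson_random_measure P N.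
Local Open Scope ereal_scope.

Lemma measurable_count_eq A (x : \bar R) : measurable A -> measurable [set w | N w A = x].
Proof.
move=> mA; rewrite -[X in measurable X]setTI.
exact: (measurable_kernel N A mA measurableT [set x] (emeasurable_set1 x)).
Qed.

Lemma measurable_count_ge A (x : \bar R) : measurable A -> measurable [set w | x <= N w A].
Proof.
move=> mA; rewrite -[X in measurable X]setTI.
have -> : [set w | x <= N w A] = (N^~ A) @^-1` `[x, +oo[.
  by apply/seteqP; split => w /=; rewrite in_itv/= andbT.
by apply: (measurable_kernel N A mA measurableT) => //; exact: emeasurable_itv.
Qed.

Lemma count_void A : measurable A -> intensity A < +oo ->
  P [set w | N w A = 0] = (expR (- fine (intensity A)))%:E.
Proof.
move=> mA ioo; case: NP => _ _ NPA _ _.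
have := NPA A mA ioo 0%N; rewrite /= => ->.
rewrite poisson_prob0// fine_ge0//; apply: integral_ge0 => x _.
by rewrite lee_fin invr_ge0 sqr_ge0.
Qed.

(** The law of a count is prescribed at single integers only. Counts being integers or infinite, the
    tail is the complement of finitely many such events. *)
Lemma count_tail A K : measurable A -> intensity A < +oo -> (0 < K)%N ->
  P [set w | K%:R%:E <= N w A] <= (fine (intensity A) ^+ K)%:E.
Proof.
move=> mA ioo K0; case: NP => _ Nint NPA _ _.
set l := fine (intensity A).
have l0 : (0 <= l)%R.
  by rewrite fine_ge0//; apply: integral_ge0 => x _; rewrite lee_fin invr_ge0 sqr_ge0.
apply: le_trans (poisson_prob_tail 0%N l0 K0).
have lowE : P (\bigcup_(k < K) [set w | N w A = k%:R%:E]) = poisson_prob l 0%N `I_K.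
  rewrite [X in poisson_prob _ _ X](_ : _ = \bigcup_(k < K) [set k]); last first.
    by apply/seteqP; split => [n /= nK|n [k /= kK ->]//]; exists n.
  rewrite !measure_fin_bigcup//.
  - by apply: eq_fsbigr => k _; exact: NPA.
  - by move=> i j _ _ [_ [/= -> ->]].
  - by move=> i j _ _ [w [/= -> /eqP]]; rewrite eqe eqr_nat => /eqP.
  - by move=> k _; exact: measurable_count_eq.
have -> : [set w | K%:R%:E <= N w A] = ~` \bigcup_(k < K) [set w | N w A = k%:R%:E].
  rewrite -[LHS]setCK; congr setC; apply/seteqP; split => [w /= /negP|w [k /= kK ->]].
    rewrite -ltNge; case: (Nint w A mA) => [->//|[n Nn]].
    by rewrite Nn lte_fin ltr_nat => nK; exists n.
  by apply/negP; rewrite -ltNge lte_fin ltr_nat.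
have -> : [set n | (K <= n)%N] = ~` `I_K.
  by apply/seteqP; split => [n /= Kn|n /= /negP]; [apply/negP|]; rewrite -?leqNgt.
rewrite !probability_setC ?lowE//.
by apply: bigcup_measurable => k _; exact: measurable_count_eq.
Qed.

Lemma borel_cantelli_expR (E : nat -> set Omega) (C t : R) :
  (0 < t)%R -> (0 <= C)%R -> (forall n, measurable (E n)) ->
  (forall n, P (E n) <= (C * expR (- (t * n%:R)))%:E) ->
  {ae P, forall w, exists n0, forall n, (n0 <= n)%N -> ~ E n w}.
Proof.
move=> t0 C0 mE PE.
have : P (lim_sup_set E) = 0.
  apply: lim_sup_set_cvg0 => //.
  have q0 : (0 <= expR (- t))%R by exact: expR_ge0.
  have q1 : (expR (- t) < 1)%R by rewrite expR_lt1 oppr_lt0.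
  apply: (@le_lt_trans _ _ (\sum_(n <oo) (C * expR (- t) ^+ n)%:E)).
    apply: lee_nneseries => // n _; apply: (le_trans (PE n)).
    by rewrite lee_fin ler_wpM2l// -expRM_natr mulNr.
  rewrite nneseries_geometric//.
  exact: ltry.
move=> h; have {}h : P.-negligible (lim_sup_set E).
  apply/negligibleP => //; apply: bigcapT_measurable => n.
  by apply: bigcup_measurable => k _; exact: mE.
apply: negligibleS h => w /= nw n _.
apply: contrapT => nE; apply: nw; exists n => k nk Ek; apply: nE.
by exists k.
Qed.

(** A union bound over the at most 2 e^n indices k <= e^n uses up the 1 of 1 + t; what is left is
    summable in n. *)
Lemma borel_cantelli_expR2 (A : nat -> nat -> set Omega) (C t : R) :
  (0 < t)%R -> (0 <= C)%R -> (forall n k, measurable (A n k)) ->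
  (forall n k, P (A n k) <= (C * expR (- ((1 + t) * n%:R)))%:E) ->
  {ae P, forall w, exists n0, forall n, (n0 <= n)%N ->
    forall k, (k%:R <= expR n%:R :> R)%R -> ~ A n k w}.
Proof.
move=> t0 C0 mA PA.
pose m n := (Num.truncn (expR n%:R : R)).+1.
have := @borel_cantelli_expR (fun n => \bigcup_(k < m n) A n k) (2 * C)%R t t0.
rewrite mulr_ge0// => /(_ isT).
case=> [n|n|B [mB B0 BE]].
- by apply: bigcup_measurable => k _; exact: mA.
- rewrite bigcup_mkord; apply: le_trans (Boole_inequality _ _) _ => //.
  apply: (@le_trans _ _ (\sum_(k < m n) (C * expR (- ((1 + t) * n%:R)))%:E)).
    by apply: lee_sum => k _; exact: PA.
  rewrite sumEFin lee_fin big_const_ord iter_addr_0 -[leLHS]mulr_natl mulrDl mul1r opprD expRD.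
  have : ((m n)%:R <= 2 * expR n%:R :> R)%R.
    have e1 : (1 <= expR (n%:R : R))%R by rewrite -expR0 ler_expR.
    have := truncn_le (expR n%:R : R); rewrite expR_ge0 => h.
    by rewrite /m -natr1; lra.
  have := expRxMexpNx_1 (n%:R : R).
  have := expR_ge0 (- n%:R : R); have := expR_ge0 (- (t * n%:R) : R).
  move: (expR n%:R) (expR (- n%:R)) (expR (- (t * n%:R))) => x y z z0 y0 xy mx.
  have -> : (2 * C * z = 2 * x * (C * (y * z)))%R.
    by transitivity (2 * C * z * (x * y))%R; [rewrite xy mulr1|ring].
  by rewrite ler_wpM2r ?mulr_ge0.
exists B; split => // w /= nw; apply: BE => /= -[n0 h]; apply: nw; exists n0 => n nn k kn Ank.
apply: (h n nn); exists k => //=; rewrite /m -(ltr_nat R).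
exact: le_lt_trans (truncnS_gt _).
Qed.

End PoissonMeasure.

Section Events.
Context {R : realType}.
Implicit Types (nu : set (R * R) -> \bar R) (g : R) (K : nat).

(** Stated for one set function, so that everything about the path is deterministic afterwards. The
    indices k <= e^n are those of the windows starting in [0, 1]. *)
Definition dense_points nu g : Prop :=
  exists n0, forall n, (n0 <= n)%N -> forall k : nat, k%:R <= expR n%:R :> R ->
  (1 <= nu (band (k%:R * expR (- n%:R)) (k.+1%:R * expR (- n%:R))
                 (expR (- (g * n%:R)))))%E.

(** With three units of length, every interval of length 2 e^-n starting in [0, 1] fits into one of
    these windows, wherever it starts. *)
Definition sparse_points nu g K : Prop :=
  exists n0, forall n, (n0 <= n)%N -> forall k : nat, k%:R <= expR n%:R :> R ->
  (nu (band (k%:R * expR (- n%:R)) ((k + 3)%:R * expR (- n%:R))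
            (expR (- (g * n%:R)))) < K%:R%:E)%E.

(** Serves times before e^-n, to the left of which no full window fits. *)
Definition quiet_start nu g : Prop :=
  exists n0, forall n, (n0 <= n)%N ->
  nu (band 0 (2 * expR (- n%:R)) (expR (- (g * n%:R)))) = 0%E.

Lemma intensity_band_expR (a b g : R) (n : nat) : 0 <= a -> a <= b -> 0 <= g ->
  intensity (band a b (expR (- (g * n%:R)))) = ((b - a) * (expR (g * n%:R) - 1))%:E.
Proof.
move=> a0 ab g0; rewrite intensity_band ?expR_gt0 -?expRN ?opprK//.
by rewrite expR_le1 oppr_le0 mulr_ge0.
Qed.

Context {d : measure_display} {Omega : measurableType d}.
Variables (P : probability Omega R) (N : R.-ker Omega ~> (R * R)%type).
Hypothesis NP : poisson_random_measure P N.

Lemma count_integer w A : measurable A ->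
  N w A = +oo%E \/ exists n : nat, N w A = n%:R%:E.
Proof. by move=> mA; case: NP => _ + _ _ _; apply. Qed.

(** A window is void with probability at most e exp(- y), where y = e^((g - 1) n). The bound exp(y)
    >= y^(K + 1) / (K + 1)! makes this smaller than a constant times e^(-2 n). *)
Lemma ae_dense_points g : 1 < g -> {ae P, forall w, dense_points (N w) g}.
Proof.
move=> g1; have g0 : 0 < g - 1 by rewrite subr_gt0.
(* Chosen so that y^(K + 1) >= e^(2 n). *)
pose K := Num.truncn (2 / (g - 1)).
have K2 : 2 <= (g - 1) * K.+1%:R.
  by rewrite mulrC -ler_pdivrMr// ltW// truncnS_gt.
pose A n k := [set w | N w (band (k%:R * expR (- n%:R)) (k.+1%:R * expR (- n%:R))
                 (expR (- (g * n%:R)))) = 0%E].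
have [||n k|B [mB B0 BE]] := @borel_cantelli_expR2 _ _ _ P A (expR 1 * K.+1`!%:R) 1 ltr01.
- by rewrite mulr_ge0 ?expR_ge0.
- by move=> n k; apply: measurable_count_eq; exact: measurable_band.
- have e0 : 0 <= expR (- n%:R : R) by exact: expR_ge0.
  have iE := @intensity_band_expR (k%:R * expR (- n%:R)) (k.+1%:R * expR (- n%:R)) g n.
  rewrite count_void//; last 2 first.
    exact: measurable_band.
    rewrite iE ?ltry ?mulr_ge0 ?ler_wpM2r ?ler_nat//; lra.
  rewrite iE ?mulr_ge0 ?ler_wpM2r ?ler_nat//; last lra.
  rewrite lee_fin /= -mulrBl -natr1 addrC addKr mul1r mulrBr mulr1 -expRD.
  have -> : - n%:R + g * n%:R = (g - 1) * n%:R :> R by ring.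
  rewrite opprB expRD -mulrA ler_pM ?expR_ge0//.
    by rewrite ler_expR expR_le1 oppr_le0.
  set y := expR ((g - 1) * n%:R).
  have y0 : 0 <= y by exact: expR_ge0.
  have yK : expR (2 * n%:R) / K.+1`!%:R <= expR y.
    apply: le_trans (expR_ge1Dxn K y0); rewrite ler_wpDl//.
    rewrite ler_pM2r ?invr_gt0 ?ltr0n ?fact_gt0// /y -expRM_natr ler_expR.
    by rewrite mulrAC ler_wpM2r.
  rewrite expRN -[K.+1`!%:R]invrK -[expR (- _)]invrK -expRN opprK -invfM mulrC.
  rewrite lef_pV2 ?posrE ?expR_gt0// ?divr_gt0 ?expR_gt0 ?ltr0n ?fact_gt0//. 
exists B; split => // w /= nw; apply: BE => /= -[n0 h]; apply: nw; exists n0.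
move=> n nn k kn; have := h n nn k kn; rewrite /A /=.
case: (@count_integer w _ (measurable_band (k%:R * expR (- n%:R)) (k.+1%:R * expR (- n%:R))
                 (expR (- (g * n%:R))))) => [->|[m ->]]; first by rewrite leey.
move=> m0; rewrite lee_fin ler1n lt0n; apply/eqP => m00; apply: m0.
by rewrite m00.
Qed.

(** The intensity of a window is at most 3 e^(-(1 - g) n). Its K-th power has to beat the e^n
    windows, hence the condition K (1 - g) > 1. *)
Lemma ae_sparse_points g K : 0 <= g -> 1 < K%:R * (1 - g) ->
  {ae P, forall w, sparse_points (N w) g K}.
Proof.
move=> g0 gK; have t0 : 0 < K%:R * (1 - g) - 1 by rewrite subr_gt0.
have K0 : (0 < K)%N by case: K gK {t0} => //; rewrite mul0r ltr10.
pose A n k := [set w | (K%:R%:E <=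
  N w (band (k%:R * expR (- n%:R)) ((k + 3)%:R * expR (- n%:R))
                 (expR (- (g * n%:R)))))%E].
have [||n k|B [mB B0 BE]] := @borel_cantelli_expR2 _ _ _ P A (3 ^+ K) _ t0.
- by rewrite exprn_ge0.
- by move=> n k; apply: measurable_count_ge; exact: measurable_band.
- have e0 : 0 <= expR (- n%:R : R) by exact: expR_ge0.
  have iE := @intensity_band_expR (k%:R * expR (- n%:R)) ((k + 3)%:R * expR (- n%:R)) g n.
  apply: le_trans (count_tail _ _ _ K0) _ => //.
    exact: measurable_band.
    by rewrite iE ?ltry ?mulr_ge0 ?ler_wpM2r ?ler_nat// leq_addr.
  rewrite iE ?mulr_ge0 ?ler_wpM2r ?ler_nat ?leq_addr// lee_fin /=.
  rewrite -mulrBl natrD addrAC subrr add0r.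
  have -> : 1 + (K%:R * (1 - g) - 1) = K%:R * (1 - g) by ring.
  have -> : - (K%:R * (1 - g) * n%:R) = (- n%:R + g * n%:R) * K%:R by ring.
  rewrite [expR ((_ + _) * _)]expRM_natr -exprMn lerXn2r ?nnegrE ?mulr_ge0 ?expR_ge0//.
    by rewrite subr_ge0 -expR0 ler_expR mulr_ge0.
  rewrite -mulrA ler_pM2l// expRD ler_wpM2l// gerBl//.
exists B; split => // w /= nw; apply: BE => /= -[n0 h]; apply: nw; exists n0.
by move=> n nn k kn; rewrite ltNge; apply/negP; exact: h n nn k kn.
Qed.

(** Only one window occurs for each n, so the first moment is summable as soon as g < 1. *)
Lemma ae_quiet_start g : 0 <= g -> g < 1 -> {ae P, forall w, quiet_start (N w) g}.
Proof.
move=> g0 g1; have t0 : 0 < 1 - g by rewrite subr_gt0.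
pose A n := [set w | (1%:R%:E <=
  N w (band 0 (2 * expR (- n%:R)) (expR (- (g * n%:R)))))%E].
have [||n|B [mB B0 BE]] := @borel_cantelli_expR _ _ _ P A 2 _ t0.
- by [].
- by move=> n; apply: measurable_count_ge; exact: measurable_band.
- have e0 : 0 <= expR (- n%:R : R) by exact: expR_ge0.
  have iE := @intensity_band_expR 0 (2 * expR (- n%:R)) g n.
  apply: le_trans (count_tail _ _ _ _) _ => //.
    exact: measurable_band.
    by rewrite iE ?ltry ?mulr_ge0.
  rewrite iE ?mulr_ge0// lee_fin /= expr1 subr0 -mulrA ler_pM2l//.
  have -> : - ((1 - g) * n%:R) = - n%:R + g * n%:R by ring.
  by rewrite expRD ler_wpM2l// gerBl.
exists B; split => // w /= nw; apply: BE => /= -[n0 h]; apply: nw; exists n0.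
move=> n nn; have := h n nn; rewrite /A /=.
case: (@count_integer w _ (measurable_band 0 (2 * expR (- n%:R))
                 (expR (- (g * n%:R))))) => [->|[m ->]]; first by rewrite leey.
by rewrite lee_fin ler_nat => /negP; rewrite -leqNgt leqn0 => /eqP ->.
Qed.

End Events.

(** * Occupation measure and increments of the path *)

Section Occupation.
Context {R : realType}.
Variable X : R -> R.
Implicit Types (A B : set R) (u v : R).
Local Notation mu := (occupation_measure X).

Lemma occupation_measure_ge0 A : (0 <= mu A)%E.
Proof. by apply: integral_ge0 => s _; rewrite lee_fin indicE ler0n. Qed.

Lemma le_occupation_measure A B : A `<=` B -> (mu A <= mu B)%E.
Proof.
move=> AB; apply: integral_mono_patch => [s _|s _|s s01 _].
- by rewrite lee_fin indicE ler0n.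
- by rewrite lee_fin indicE ler0n.
- split => //; rewrite lee_fin !indicE ler_nat.
  by have [/set_mem/AB/mem_set ->|] := boolP (X s \in A).
Qed.

Lemma lebesgue_measure_itvcc u v : u <= v ->
  lebesgue_measure (`[u, v] : set R) = (v - u)%:E.
Proof.
rewrite lebesgue_measure_itv/= lte_fin le_eqVlt => /predU1P[->|->]; last by rewrite EFinB.
by rewrite ltxx subrr.
Qed.

Lemma occupation_measure_le A u v : u <= v ->
  (forall s, 0 <= s <= 1 -> A (X s) -> u <= s <= v) -> (mu A <= (v - u)%:E)%E.
Proof.
move=> uv Auv; rewrite -lebesgue_measure_itvcc// -[leRHS]mul1e -integral_cst//.
apply: integral_mono_patch => [s _|s _|s /= s01 As].
- by rewrite lee_fin indicE ler0n.
- by rewrite /= lee_fin.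
- move: As; rewrite indicE; have [/set_mem As _|] := boolP (X s \in A); last by rewrite eqxx.
  by split => //; rewrite /= in_itv/=; apply: Auv => //; move: s01; rewrite in_itv.
Qed.

Lemma occupation_measure_ge A u v : 0 <= u -> u <= v -> v <= 1 ->
  (forall s, u <= s <= v -> A (X s)) -> ((v - u)%:E <= mu A)%E.
Proof.
move=> u0 uv v1 Auv; rewrite -lebesgue_measure_itvcc// -[leLHS]mul1e -integral_cst//.
apply: integral_mono_patch => [s _|s _|s /=].
- by rewrite /= lee_fin.
- by rewrite lee_fin indicE ler0n.
- rewrite in_itv/= => suv _; rewrite indicE mem_set; last exact: Auv.
  by split => //; move/andP: suv => [us sv]; rewrite in_itv/= (le_trans u0 us) (le_trans sv v1).
Qed.

Lemma occupation_measure_lty A : (mu A < +oo)%E.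
Proof.
apply: le_lt_trans (@occupation_measure_le A 0 1 ler01 _) (ltry _).
by move=> s.
Qed.

Lemma occupation_measure_gt0 A : (0 < mu A)%E -> exists2 s, 0 <= s <= 1 & A (X s).
Proof.
move=> mA; apply: contrapT => nA; move: mA.
suff : (mu A <= (0 - 0)%:E)%E by rewrite leNgt subrr => /negPf ->.
by apply: occupation_measure_le => // s s01 As; exfalso; apply: nA; exists s.
Qed.

End Occupation.

(** Overlaps among the [B i] do no harm: f is compared with the sum of all the functions a_i 1_(B
    i), which exceeds each of its terms. *)
Lemma integral_le_nneseries d (T : measurableType d) (R : realType)
    (m : {measure set T -> \bar R}) (D : set T) (f : T -> R) (a : R ^nat)
    (B : (set T) ^nat) :
  (forall x, D x -> 0 <= f x) -> (forall i, 0 <= a i) -> (forall i, measurable (B i)) ->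
  (forall x, D x -> exists2 i, B i x & f x <= a i) ->
  (\int[m]_(x in D) (f x)%:E <= \sum_(i <oo) (a i)%:E * m (B i))%E.
Proof.
move=> f0 a0 mB fa.
pose h (i : nat) (x : T) : \bar R := ((a i)%:E * (\1_(B i) x)%:E)%E.
have h0 i x : (0 <= h i x)%E by rewrite mule_ge0 ?lee_fin// indicE ler0n.
apply: (@le_trans _ _ (\int[m]_x (\sum_(i <oo) h i x))%E).
  apply: integral_mono_patch => [x /f0|x _|x Dx _]; first by rewrite lee_fin.
    by apply: nneseries_ge0 => n _ _.
  split => //; have [i Bi fai] := fa x Dx.
  apply: le_trans (nneseries_lim_ge i.+1 _); last by move=> *; exact: h0.
  rewrite big_nat_recr//= -[leLHS]add0e; apply: leeD.
    by apply: sume_ge0 => k _; exact: h0.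
  by rewrite /h indicE mem_set// mule1 lee_fin.
rewrite integral_nneseries//; last first.
  by move=> n; apply/measurable_EFinP; apply: measurable_funM => //; exact: measurable_indic.
apply: lee_nneseries => [n _ _|n _]; first by apply: integral_ge0 => x _; exact: h0.
rewrite ge0_integralZl_EFin//.
- by rewrite integral_indic// setIT.
- by apply/measurable_EFinP; exact: measurable_indic.
Qed.

(** * Time windows of length e^-n *)

Section Windows.
Context {R : realType}.
Implicit Types (s t : R) (n k : nat).

Lemma window_cover n s : 0 <= s <= 1 ->
  exists2 k, k%:R <= expR n%:R :> R &
    k%:R * expR (- n%:R) <= s < k.+1%:R * expR (- n%:R).
Proof.
move=> /andP[s0 s1]; have e0 := expR_gt0 (n%:R : R).
have se0 : 0 <= s * expR n%:R by rewrite mulr_ge0 ?expR_ge0.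
have /andP[h1 h2] := truncn_itv se0.
exists (Num.truncn (s * expR n%:R)).
  by rewrite (le_trans h1)// ler_piMl// ltW.
by rewrite expRN ler_pdivrMr// ltr_pdivlMr// h1.
Qed.

(** The window following the one that contains s ends before s + 2 e^-n. *)
Lemma window_inside n s t : 0 <= s -> s + 2 * expR (- n%:R) <= t -> t <= 1 ->
  exists k, [/\ k%:R <= expR n%:R :> R, s <= k%:R * expR (- n%:R) &
    k.+1%:R * expR (- n%:R) <= t].
Proof.
move=> s0 st t1; have e0 := expR_gt0 (- n%:R : R).
have [|k _ /andP[h1 h2]] := @window_cover n s; first by rewrite s0; lra.
have k2 : k.+2%:R * expR (- n%:R) <= t.
  move: h1 st; rewrite -[k.+2%:R]natr1 -[k.+1%:R]natr1; lra.
exists k.+1; split => //; last exact: ltW.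
have : k.+1%:R * expR (- n%:R) <= 1 :> R.
  by rewrite (le_trans _ t1)// (le_trans _ k2)// ler_wpM2r ?ler_nat// ltW.
by rewrite expRN ler_pdivrMr ?expR_gt0// mul1r.
Qed.

Lemma band_subset (a b a' b' c : R) : a' <= a -> b <= b' -> band a b c `<=` band a' b' c.
Proof.
move=> aa bb [x z] [/=]; rewrite !in_itv/= => /andP[ax xb] zc; split => //=.
by rewrite ?in_itv/= (le_lt_trans aa ax) (le_trans xb bb).
Qed.

Lemma expR_lt_near0 (a e : R) : 0 < a -> 0 < e ->
  exists n0, forall n, (n0 <= n)%N -> expR (- (a * n%:R)) < e.
Proof.
move=> a0 e0; exists (Num.truncn (`|ln e| / a)).+1 => n nn.
rewrite -[ltRHS]lnK ?posrE// ltr_expR.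
have : `|ln e| / a < n%:R by apply: lt_le_trans (truncnS_gt _) _; rewrite ler_nat.
rewrite ltr_pdivrMr// => h; have := ler_norm (- ln e); rewrite normrN; lra.
Qed.

Lemma sparse_points_band (nu : {measure set (R * R) -> \bar R}) (g : R) (K : nat) :
  sparse_points nu g K ->
  exists n0, forall n, (n0 <= n)%N -> forall u v : R, 0 <= u -> u <= 1 ->
    v <= u + 2 * expR (- n%:R) ->
    (nu (band u v (expR (- (g * n%:R)))) < K%:R%:E)%E.
Proof.
move=> [n0 sp]; exists n0 => n nn u v u0 u1 vu.
have [|k k1 /andP[h1 h2]] := @window_cover n u; first by rewrite u0.
apply: le_lt_trans (sp n nn k k1); apply: le_measure; rewrite ?inE; try exact: measurable_band.
apply: band_subset => //; apply: (le_trans vu).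
by move: h2; rewrite natrD -natr1; have := expR_gt0 (- n%:R : R); lra.
Qed.

(** At most 2 e^n windows cover ]0, 1], each with fewer than K atoms. *)
Lemma sparse_points_total (nu : {measure set (R * R) -> \bar R}) (g : R) (K : nat) :
  sparse_points nu g K ->
  exists n0, forall n, (n0 <= n)%N ->
    (nu (band 0 1 (expR (- (g * n%:R)))) <= (2 * K%:R * expR n%:R)%:E)%E.
Proof.
move=> [n0 sp]; exists n0 => n nn.
pose W k : set (R * R) :=
  band (k%:R * expR (- n%:R)) ((k + 3)%:R * expR (- n%:R)) (expR (- (g * n%:R))).
pose m := (Num.truncn (expR n%:R : R)).+1.
have mW k : measurable (W k) by exact: measurable_band.
apply: (@le_trans _ _ (nu (\big[setU/set0]_(k < m) W k))).
  apply: le_measure; rewrite ?inE; [exact: measurable_band|exact: bigsetU_measurable|].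
  rewrite -bigcup_mkord => -[s z] [/=]; rewrite !in_itv/= => /andP[s0 s1] zc.
  have [|k k1 /andP[h1 h2]] := @window_cover n s; first by rewrite (ltW s0).
  (* Windows in [window_cover] are closed on the left, bands are open there. Stepping back by one
     index keeps the case s = k e^-n, and for k = 0 the positivity of s is enough. *)
  exists k.-1 => /=.
    rewrite (leq_ltn_trans (leq_pred k))// /m ltnS truncn_ge_nat//.
  split => //=; rewrite in_itv/= -addn1 in h2 *; apply/andP; split.
    case: k h1 {k1 h2} => [|k]; first by rewrite mul0r.
    by apply: lt_le_trans; rewrite ltr_pM2r ?expR_gt0// ltr_nat.
  apply: ltW; apply: (lt_le_trans h2); rewrite ler_wpM2r ?expR_ge0// ler_nat.
  by case: k {h1 k1 h2} => //= k; rewrite addn1 addn3 ltnS ltnW// ltnW.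
apply: le_trans (Boole_inequality _ _) _ => //.
apply: (@le_trans _ _ (\sum_(k < m) K%:R%:E)%E).
  apply: lee_sum => k _; apply: ltW; apply: sp => //.
  have km : (k <= Num.truncn (expR n%:R : R))%N by exact: ltn_ord k.
  by apply: (@le_trans _ _ (Num.truncn (expR n%:R : R))%:R); rewrite ?ler_nat// truncn_le expR_ge0.
rewrite sumEFin lee_fin big_const_ord iter_addr_0 -[leLHS]mulr_natl mulrAC.
rewrite ler_wpM2r// /m -natr1.
have e1 : 1 <= expR (n%:R : R) by rewrite -expR0 ler_expR.
by have := truncn_le (expR n%:R : R); rewrite expR_ge0; lra.
Qed.

End Windows.

(* The constants satisfy K (1 - g) > 1, as ae_sparse_points requires. *)
Definition regular_points {R : realType} (nu : set (R * R) -> \bar R) : Prop :=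
  [/\ forall m : nat, dense_points nu (1 + m.+1%:R^-1),
      forall m : nat, sparse_points nu (2^-1 - m.+3%:R^-1) 2,
      forall m : nat, quiet_start nu (2^-1 - m.+3%:R^-1)
    & forall K : nat, sparse_points nu (1 - 2 * K.+2%:R^-1) K.+2].

(** Countably many exponents, approaching 1 from above, 1/2 from below and 1 from below, leave a
    single null set to discard. *)
Lemma ae_regular_points {R : realType} {d : measure_display} {Omega : measurableType d}
    (P : probability Omega R) (N : R.-ker Omega ~> (R * R)%type) :
  poisson_random_measure P N -> {ae P, forall w, regular_points (N w)}.
Proof.
move=> NP.
have mi (m k : nat) : (0 < k)%N -> 0 < (m + k)%:R^-1 :> R /\ (m + k)%:R^-1 <= k%:R^-1 :> R.
  move=> k0; rewrite invr_gt0 ltr0n addn_gt0 k0 orbT; split => //.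
  by rewrite lef_pV2 ?posrE ?ltr0n ?addn_gt0 ?k0 ?orbT// ler_nat leq_addl.
have a1 : {ae P, forall w, forall m : nat, dense_points (N w) (1 + m.+1%:R^-1)}.
  apply: ae_foralln => m; apply: (ae_dense_points NP).
  by have [+ _] := mi m 1%N isT; rewrite addn1; move: (_^-1) => i; lra.
have a2 : {ae P, forall w, forall m : nat, sparse_points (N w) (2^-1 - m.+3%:R^-1) 2}.
  by apply: ae_foralln => m; have [+ +] := mi m 3 isT; rewrite addn3;
    move: (m.+3%:R^-1) => i ? ?; apply: (ae_sparse_points NP); lra.
have a3 : {ae P, forall w, forall m : nat, quiet_start (N w) (2^-1 - m.+3%:R^-1)}.
  by apply: ae_foralln => m; have [+ +] := mi m 3 isT; rewrite addn3;
    move: (m.+3%:R^-1) => i ? ?; apply: (ae_quiet_start NP); lra.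
have a4 : {ae P, forall w, forall K : nat, sparse_points (N w) (1 - 2 * K.+2%:R^-1) K.+2}.
  apply: ae_foralln => K; have [h1 h2] := mi K 2 isT; rewrite addn2 in h1 h2.
  apply: (ae_sparse_points NP); first by move: (K.+2%:R^-1) h1 h2 => k; lra.
  (* Here K (1 - g) takes the value 2. *)
  by rewrite opprB addrC subrK mulrCA divff ?mulr1 ?ltr1n// pnatr_eq0.
by apply: filterS2 (filterI a1 a2) (filterI a3 a4) => w [? ?] [? ?].
Qed.

(** * Increments and local dimensions of a deterministic path *)

Section Path.
Context {R : realType}.
Variables (eps0 : R) (beta X : R -> R) (nu : {measure set (R * R) -> \bar R}).
Hypothesis eps0_gt0 : 0 < eps0.
Hypothesis beta_range : forall x, eps0 <= beta x <= 1 - eps0.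
Hypothesis beta_nondecreasing : {homo beta : x y / x <= y}.
Hypothesis X_cadlag : cadlag X.
Hypothesis X_int : forall t : R, 0 <= t <= 1 ->
  (X t)%:E = (\int[nu]_(p in `]0%R, t] `*` `]0%R, 1%R])
                (p.2 `^ (beta (left_limit X p.1))^-1)%:E)%E.
Local Notation f := (fun p : R * R => p.2 `^ (beta (left_limit X p.1))^-1).

Implicit Types s t x u v : R.

Lemma beta_gt0 x : 0 < beta x.
Proof. by have /andP[h _] := beta_range x; exact: lt_le_trans h. Qed.

Lemma path_nondecreasing s t : 0 <= s -> s <= t -> t <= 1 -> X s <= X t.
Proof.
move=> s0 st t1; rewrite -lee_fin !X_int ?s0 ?t1 ?(le_trans s0 st) ?(le_trans st t1)//.
apply: integral_mono_patch => [p _|p _|[u z] [/=]].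
- by rewrite lee_fin powR_ge0.
- by rewrite lee_fin powR_ge0.
- rewrite !in_itv/= => /andP[u0 us] z01 _; split => //.
  by rewrite /= ?in_itv/= u0 (le_trans us st).
Qed.

Lemma left_limit_cvg t : 0 < t -> t <= 1 -> X s @[s --> t^'-] --> left_limit X t.
Proof. by move=> t0 t1; have [_] := X_cadlag; apply; rewrite t0. Qed.

Lemma path_le_left_limit s t : 0 <= s -> s < t -> t <= 1 -> X s <= left_limit X t.
Proof.
move=> s0 st t1; have t0 := le_lt_trans s0 st.
have cX := left_limit_cvg t0 t1.
rewrite /left_limit; apply: limr_ge; first by apply: cvgP cX.
near=> u; apply: path_nondecreasing => //.
- by near: u; apply: nbhs_left_ge.
- by apply: le_trans t1; near: u; exact: nbhs_left_le.
Unshelve. all: by end_near. Qed.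

Lemma left_limit_le_path t : 0 < t -> t <= 1 -> left_limit X t <= X t.
Proof.
move=> t0 t1; have cX := left_limit_cvg t0 t1.
rewrite /left_limit; apply: limr_le; first by apply: cvgP cX.
near=> u; apply: path_nondecreasing => //.
- by near: u; apply: nbhs_left_ge.
Unshelve. all: by end_near. Qed.

Lemma left_limit_gt t x : 0 < t -> t <= 1 -> x < left_limit X t ->
  exists2 s, 0 < s < t & x < X s.
Proof.
move=> t0 t1 xt; have cX := left_limit_cvg t0 t1.
suff : \forall s \near t^'-, 0 < s < t /\ x < X s.
  by move=> /filter_ex[s [? ?]]; exists s.
near=> s; split; last by near: s; exact: (cvgr_gt _ cX).
apply/andP; split; near: s; [exact: nbhs_left_gt|exact: nbhs_left_lt].
Unshelve. all: by end_near. Qed.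

(** The path is monotone, hence so is the exponent as a function of time, and monotone functions are
    measurable. *)
Lemma measurable_jump_size : measurable_fun (`]0%R, 1%R] `*` `]0%R, 1%R] : set (R * R)) f.
Proof.
(* A monotone extension to the whole line, as the path is arbitrary off [0, 1]. *)
pose g u := if u <= 0 then beta 0 else if u <= 1 then beta (left_limit X u) else beta (X 1).
have X0 : X 0 = 0.
  by apply: EFin_inj; rewrite X_int ?lexx//= set_itv_ge ?bnd_simp ?ltxx// set0X integral_set0.
have g_nd : nondecreasing_fun g.
  move=> u v uv; rewrite /g; case: (leP v 0) => v0.
    by rewrite (le_trans uv v0).
  case: (leP u 0) => u0.
    case: (leP v 1) => v1; apply: beta_nondecreasing.
      by rewrite -X0; exact: path_le_left_limit.
    by rewrite -X0; exact: path_nondecreasing.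
  case: (leP v 1) => v1.
    rewrite (le_trans uv v1); move: uv; rewrite le_eqVlt => /predU1P[->//|uv].
    apply: beta_nondecreasing; apply: (@le_trans _ _ (X u)).
      by apply: left_limit_le_path => //; exact: le_trans (ltW uv) v1.
    by apply: path_le_left_limit => //; exact: ltW.
  case: (leP u 1) => // u1; apply: beta_nondecreasing; apply: (@le_trans _ _ (X u)).
    exact: left_limit_le_path.
  by apply: path_nondecreasing => //; exact: ltW.
have g0 u : 0 < g u by rewrite /g; case: ifP => _; [|case: ifP => _]; exact: beta_gt0.
have mg : measurable_fun setT (fun u => (g u)^-1).
  apply: nonincreasing_measurable => // u v uv.
  by rewrite lef_pV2 ?posrE//; exact: g_nd.
apply: (@eq_measurable_fun _ _ _ _ _ (fun p : R * R => expR ((g p.1)^-1 * ln p.2))).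
  move=> [u z] /set_mem[/=]; rewrite !in_itv/= => /andP[u0 u1] /andP[z0 _].
  by rewrite /g leNgt u0/= u1 /powR gt_eqF.
apply: measurable_funTS; apply: measurableT_comp; first exact: measurable_expR.
apply: measurable_funM; first exact: measurableT_comp mg (@measurable_fst _ _ _ _).
exact: measurableT_comp (@measurable_ln _) (@measurable_snd _ _ _ _).
Qed.

Lemma path_increment s t : 0 <= s -> s <= t -> t <= 1 ->
  (X t - X s)%:E = (\int[nu]_(p in `]s, t] `*` `]0%R, 1%R]) (f p)%:E)%E.
Proof.
move=> s0 st t1; rewrite EFinB !X_int ?s0 ?t1 ?(le_trans s0 st) ?(le_trans st t1)//.
have -> : `]0, t] `*` `]0, 1] = (`]0, s] `*` `]0, 1]) `|` (`]s, t] `*` `]0, 1]) :> set (R * R).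
  apply/seteqP; split => [[x y] [/=]|[x y] [[/=]|[/=]]]; rewrite ?in_itv/=.
  - by move=> /andP[x0 xt] y01; case: (leP x s) => xs; [left|right];
      split => //=; rewrite ?in_itv/= ?x0 ?xs.
  - by move=> /andP[x0 xs] y01; split => //=; rewrite ?in_itv/= x0 (le_trans xs st).
  - by move=> /andP[sx xt] y01; split => //=; rewrite ?in_itv/= xt (le_lt_trans s0 sx).
rewrite ge0_integral_setU/=.
(* The integral up to s is the real number X s, so it can be cancelled. *)
- rewrite addeAC subee ?add0e// -X_int ?s0 ?(le_trans st t1)//.
- exact: measurableX.
- exact: measurableX.
- apply/measurable_EFinP; apply: measurable_funS measurable_jump_size => //.
    exact: measurableX.
  move=> [x y] [] [/=]; rewrite !in_itv/= => /andP[x0 x1] y01; split => //=; rewrite ?in_itv/=.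
    by rewrite x0 (le_trans x1 (le_trans st t1)).
  by rewrite (le_lt_trans s0 x0) (le_trans x1 t1).
- by move=> p _; rewrite lee_fin powR_ge0.
- apply/disj_setPS => -[x y] [[/= + _] [/= + _]]; rewrite !in_itv/= => /andP[_ xs] /andP[sx _].
  by have := lt_le_trans sx xs; rewrite ltxx.
Qed.

(** For a mark below 1 the jump grows with beta, so an upper bound on beta bounds it from above. *)
Lemma jump_size_le y b u z : 0 <= y -> 0 < b -> 0 < z -> z <= expR (- y) ->
  beta (left_limit X u) <= b -> f (u, z) <= expR (- (y / b)).
Proof.
move=> y0 b0 z0 zy ub; rewrite /= /powR gt_eqF// ler_expR.
have lz : ln z <= - y by rewrite -[leRHS]expRK ler_ln ?posrE ?expR_gt0.
rewrite -[leLHS]opprK -mulrN lerN2 mulrC.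
apply: ler_pM => //; last by rewrite lerNr.
- by rewrite invr_ge0 ltW.
- by rewrite lef_pV2 ?posrE ?beta_gt0.
Qed.

(** One atom is enough: it comes after time s, so beta is at least b just before it. *)
Lemma path_increment_ge s t y b : 0 <= s -> s <= t -> t <= 1 -> 0 <= y -> 0 < b ->
  b <= beta (X s) -> (1 <= nu (band s t (expR (- y))))%E ->
  expR (- (y / b)) <= X t - X s.
Proof.
move=> s0 st t1 y0 b0 bX nu1; rewrite -lee_fin path_increment//.
apply: (@le_trans _ _ (\int[nu]_(p in band s t (expR (- y))) (expR (- (y / b)))%:E)%E).
  rewrite integral_cst; last exact: measurable_band.
  by rewrite -[leLHS]mule1 lee_wpmul2l// lee_fin expR_ge0.
apply: integral_mono_patch => [p _|p _|[u z] [/=]].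
- by rewrite lee_fin expR_ge0.
- by rewrite lee_fin powR_ge0.
- rewrite !in_itv/= => /andP[su ut] /andP[yz z1] _; split.
    by split => /=; rewrite ?in_itv/= ?su ?ut ?z1 ?(lt_trans (expR_gt0 _) yz).
  have z0 : 0 < z by exact: lt_trans (expR_gt0 _) yz.
  have lz : - ln z <= y by rewrite lerNl -[leLHS]expRK ler_ln ?posrE ?expR_gt0// ltW.
  have lz0 : 0 <= - ln z by rewrite oppr_ge0 ln_le0.
  rewrite lee_fin /powR gt_eqF// ler_expR.
  have bu : b <= beta (left_limit X u).
    apply: (le_trans bX); apply: beta_nondecreasing.
    by apply: path_le_left_limit => //; exact: le_trans ut t1.
  rewrite lerNl -mulrN mulrC.
  apply: ler_pM => //; first by rewrite invr_ge0 ltW// beta_gt0.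
  by rewrite lef_pV2 ?posrE ?beta_gt0.
Qed.

(** Marks of order e^(-g2 m) give jumps of order at most e^(-g2 m / b), and there are O(e^m) of them
    on [0, 1]. As g2 / b >= g / b + 1, their total is at most of order e^(-g m / b), summable over m
    >= n. *)
Lemma path_increment_le (g g2 b : R) (K : nat) :
  0 < g -> 0 < b -> g + b <= g2 -> sparse_points nu g2 K ->
  exists C : R, 0 < C /\ exists n0 : nat, forall n, (n0 <= n)%N -> forall u v,
    0 <= u -> u <= v -> v <= 1 -> v <= u + expR (- n%:R) ->
    (forall y, u < y <= v -> beta (left_limit X y) <= b) ->
    nu (band u v (expR (- (g * n%:R)))) = 0%E ->
    X v - X u <= C * expR (- (g / b * n%:R)).
Proof.
move=> g0 b0 gb2 sp; have g20 : 0 < g2 by lra.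
have [n1 sp1] := sparse_points_band sp; have [n2 sp2] := sparse_points_total sp.
pose q := expR (- (g / b)).
have q0 : 0 <= q by exact: expR_ge0.
have gb0 : 0 < g / b by exact: divr_gt0.
have q1 : q < 1 by rewrite expR_lt1 oppr_lt0.
have C20 : 0 <= 2 * K%:R * expR 1 * (1 - q)^-1.
  by rewrite !mulr_ge0 ?expR_ge0// invr_ge0 subr_ge0 ltW.
(* K counts the marks between e^(-g2 n) and e^(-g n), the second term sums the geometric series of
   the shells, and 1 ensures positivity. *)
exists (K%:R + 2 * K%:R * expR 1 * (1 - q)^-1 + 1); split.
  by rewrite ltr_wpDl// addr_ge0.
exists (maxn n1 n2) => n; rewrite geq_max => /andP[n1n n2n] u v u0 uv v1 vu bu nu0.
rewrite -lee_fin path_increment//.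
(* The constant a i dominates the jump sizes on B i: atoms of mark above
   e^(-g n) (there are none), between e^(-g2 n) and e^(-g n), and finally in
   the shells of the marks below e^(-g2 n). *)
pose a i := match i with 0%N => 1 | 1%N => expR (- (g / b * n%:R))
  | i.+2 => expR (- (g2 * (n + i)%:R / b)) end.
pose B i := match i with 0%N => band u v (expR (- (g * n%:R)))
  | 1%N => band u v (expR (- (g2 * n%:R)))
  | i.+2 => band 0 1 (expR (- (g2 * (n + i).+1%:R))) end.
have a0 i : 0 <= a i by case: i => [|[|i]] //=; exact: expR_ge0.
have mB i : measurable (B i) by case: i => [|[|i]]; exact: measurable_band.
apply: (@le_trans _ _ (\sum_(i <oo) (a i)%:E * nu (B i))%E).
  apply: integral_le_nneseries => // [p _|[y z] [/=]]; first exact: powR_ge0.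
  rewrite !in_itv/= => yuv /andP[z0 z1].
  have by_ := bu y yuv; move: yuv => /andP[uy yv].
  case: (ltP (expR (- (g * n%:R))) z) => zg.
    exists 0%N; first by split; rewrite /= in_itv/= ?uy ?zg.
    (* The bound 1 is the case y = 0 of [jump_size_le]. *)
    by rewrite /= -expR0 -oppr0 -[0](mul0r b^-1); apply: jump_size_le; rewrite ?oppr0 ?expR0.
  case: (ltP (expR (- (g2 * n%:R))) z) => zg2.
    exists 1%N; first by split; rewrite /= in_itv/= ?uy ?zg2.
    by rewrite [a 1]/= mulrAC; apply: jump_size_le => //; rewrite mulr_ge0// ltW.
  (* This r solves z = e^(-g2 r); its integer part is the number of the shell of z. *)
  pose r := - ln z / g2.
  have nr : n%:R <= r.
    by rewrite ler_pdivlMr// mulrC lerNr -[leRHS]expRK ler_ln ?posrE ?expR_gt0.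
  have /andP[r1 r2] := truncn_itv (le_trans (ler0n _ _) nr).
  have nm : (n <= Num.truncn r)%N by rewrite truncn_ge_nat// (le_trans _ nr).
  exists (Num.truncn r - n).+2.
    rewrite /= subnKC//; split; rewrite /= in_itv/=.
      by rewrite (le_lt_trans u0 uy) (le_trans yv v1).
    rewrite z1 andbT -[ltRHS]lnK ?posrE// ltr_expR ltrNl.
    by move: r2; rewrite /r ltr_pdivrMr// mulrC.
  rewrite [a _]/= subnKC//; apply: jump_size_le => //; first by rewrite mulr_ge0// ltW.
  rewrite -[leLHS]lnK ?posrE// ler_expR lerNr.
  by move: r1; rewrite /r ler_pdivlMr// mulrC.
have t0 i : (0 <= (a i)%:E * nu (B i))%E by rewrite mule_ge0 ?lee_fin.
rewrite (nneseries_split 0 2)//.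
rewrite add0n big_nat_recr//= big_nat1 [B 0]/= nu0 mule0 add0e -nneseries_addn//.
apply: (@le_trans _ _ ((K%:R * expR (- (g / b * n%:R)))%:E +
    \sum_(i <oo) (2 * K%:R * expR 1 * expR (- (g / b * n%:R)) * q ^+ i)%:E)%E).
  apply: leeD.
    rewrite [K%:R * _]mulrC EFinM lee_wpmul2l ?lee_fin ?expR_ge0// ltW// sp1 ?(le_trans uv v1)//.
    by apply: (le_trans vu); rewrite lerD2l ler_peMl ?expR_ge0// ler1n.
  apply: lee_nneseries => [i _ _|i _]; first exact: t0.
  rewrite addn2 [a _]/= [B _]/=.
  apply: (@le_trans _ _ ((expR (- (g2 * (n + i)%:R / b)))%:E *
      (2 * K%:R * expR (n + i).+1%:R)%:E)%E).
    rewrite lee_wpmul2l ?lee_fin ?expR_ge0// sp2// (leq_trans n2n)// -addnS leq_addr//.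
  rewrite -EFinM lee_fin /q -expRM_natr mulrCA -!mulrA ler_wpM2l// ler_wpM2l//.
  rewrite -!expRD ler_expR -natr1.
  (* This is where g + b <= g2 enters: the extra 1 pays for the number of atoms in the shell. *)
  have : (g / b + 1) * (n + i)%:R <= g2 / b * (n + i)%:R.
    by rewrite ler_wpM2r// -[1](divff (lt0r_neq0 b0)) -mulrDl ler_pM2r ?invr_gt0.
  rewrite natrD; lra.
rewrite nneseries_geometric// -EFinD lee_fin.
have e0 := expR_ge0 (- (g / b * n%:R)).
lra.
Qed.

(** Between s and t lies a full window with an atom, and every atom of mark at most 1 makes the path
    jump up. *)
Lemma path_increasing s t : (exists g, 0 < g /\ dense_points nu g) ->
  0 <= s -> s < t -> t <= 1 -> X s < X t.
Proof.
move=> [g [g0 [n0 dn]]] s0 st t1.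
have [|n1 hn1] := @expR_lt_near0 _ 1 ((t - s) / 2) ltr01; first by rewrite divr_gt0// subr_gt0.
pose n := maxn n0 n1.
have := hn1 n (leq_maxr _ _); rewrite mul1r => en.
have [|k [k1 k2 k3]] := @window_inside _ n s t s0 _ t1; first lra.
have d0 : 0 <= expR (- n%:R : R) by exact: expR_ge0.
have k4 : k%:R * expR (- n%:R) <= k.+1%:R * expR (- n%:R) :> R by rewrite ler_wpM2r// ler_nat.
have k5 := le_trans k4 (le_trans k3 t1).
have h := @path_increment_ge (k%:R * expR (- n%:R)) (k.+1%:R * expR (- n%:R)) (g * n%:R)
  (beta (X (k%:R * expR (- n%:R)))) (mulr_ge0 (ler0n _ _) d0) k4 (le_trans k3 t1)
  (mulr_ge0 (ltW g0) (ler0n _ _)) (beta_gt0 _) (lexx _) (dn n (leq_maxl _ _) k k1).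
have h0 := expR_gt0 (- (g * n%:R / beta (X (k%:R * expR (- n%:R))))).
have := path_nondecreasing s0 k2 k5.
have := path_nondecreasing (le_trans (mulr_ge0 (ler0n R k) d0) k4) k3 t1.
lra.
Qed.

(** Two times at which the path is r-close to x cannot enclose a full window, across which it would
    move by at least 2 r. *)
Lemma upper_local_dim_ge_path x b r0 :
  (forall m : nat, dense_points nu (1 + m.+1%:R^-1)) -> 0 < b -> 0 < r0 ->
  (forall s, 0 <= s <= 1 -> `|x - X s| < r0 -> b <= beta (X s)) ->
  msupport (occupation_measure X) x ->
  (b%:E <= upper_local_dim (occupation_measure X) x)%E.
Proof.
move=> dn b0 r00 bX xs; apply/lee_subgt0Pr => e e0; rewrite -EFinB.
(* Makes 1 / (m + 1) small enough for b / g >= b - e, where g = 1 + 1 / (m + 1). *)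
pose m := Num.truncn (b / e).
have [i iE] : exists i : R, i = m.+1%:R^-1 by exists m.+1%:R^-1.
pose g : R := 1 + i.
have i0 : 0 < i by rewrite iE invr_gt0.
have g0 : 0 < g by rewrite /g; lra.
have beg : b - e <= (g / b)^-1.
  rewrite invf_div ler_pdivlMr//.
  have : b * i <= e.
    by rewrite iE ler_pdivrMr// mulrC -ler_pdivrMr// ltW// truncnS_gt.
  have : 0 <= e * i by rewrite mulr_ge0// ltW.
  rewrite /g; lra.
apply: (@le_trans _ _ (g / b)^-1%:E); first by rewrite lee_fin.
have gb0 : 0 < g / b by exact: divr_gt0.
have [n1 hn1] := dn m; rewrite -iE -/g in hn1; have [n2 hn2] := expR_lt_near0 gb0 r00.
(* The factor e^-1 <= 1/2 keeps the diameter 2 r within the increment over a window; 4 stands for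
   two window lengths on either side of an occupied time. *)
apply: (@upper_local_dim_ge _ _ _ (-1) 4 _ (maxn n1 n2)) => //.
  exact: occupation_measure_lty.
move=> n; rewrite geq_max => /andP[n1n n2n].
set r := expR (-1 - g / b * n%:R); set d := expR (- n%:R).
have d0 : 0 < d by exact: expR_gt0.
have rE : 2 * r <= expR (- (g / b * n%:R)).
  rewrite /r expRD mulrA ler_piMl ?expR_ge0// expRN ler_pdivrMr ?expR_gt0// mul1r.
  by have := expR_ge1Dx (1 : R); lra.
have r_gt0 : 0 < r by exact: expR_gt0.
have rr0 : r < r0 by have := hn2 n n2n; lra.
have mu0 := xs r r_gt0; rewrite mu0 /=.
have near s1 s2 : 0 <= s1 <= 1 -> 0 <= s2 <= 1 -> `|x - X s1| < r ->
    `|x - X s2| < r -> s2 <= s1 + 2 * d.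
  move=> s101 /andP[s20 s21] xs1 xs2; rewrite leNgt; apply/negP => s12.
  have bs1 := bX s1 s101 (lt_trans xs1 rr0); move: s101 => /andP[s10 s11].
  have [k [k1 k2 k3]] := window_inside s10 (ltW s12) s21.
  have kd0 : 0 <= k%:R * d by apply: mulr_ge0 (ler0n _ _) (ltW d0).
  have k4 : k%:R * d <= k.+1%:R * d by rewrite ler_wpM2r ?ler_nat// ltW.
  have k5 := le_trans k4 (le_trans k3 s21).
  have X1 := path_nondecreasing s10 k2 k5.
  have X2 := path_nondecreasing (le_trans kd0 k4) k3 s21.
  have := @path_increment_ge (k%:R * d) (k.+1%:R * d) (g * n%:R) b kd0 k4
    (le_trans k3 s21) (mulr_ge0 (ltW g0) (ler0n _ _)) b0
    (le_trans bs1 (beta_nondecreasing X1)) (hn1 n n1n k k1).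
  rewrite mulrAC; move: xs1 xs2; rewrite !ltr_norml => /andP[? ?] /andP[? ?].
  lra.
have [s0 s01 xs0] := occupation_measure_gt0 mu0.
have -> : 4 * d = (s0 + 2 * d) - (s0 - 2 * d) by ring.
apply: occupation_measure_le; first lra.
move=> s s01' xs'.
have := near s s0 s01' s01 xs' xs0; have := near s0 s s01 s01' xs0 xs'; lra.
Qed.

Hypothesis nu_integer : forall A, measurable A ->
  nu A = +oo%E \/ exists n : nat, nu A = n%:R%:E.

(** Two integer counts with sum below 2 cannot both be positive. *)
Lemma band_lt2_split (a b c d : R) : a <= b -> b <= c -> (nu (band a c d) < 2%:R%:E)%E ->
  nu (band a b d) = 0%E \/ nu (band b c d) = 0%E.
Proof.
move=> ab bc; have -> : band a c d = band a b d `|` band b c d.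
  apply/seteqP; split => [[x y] [/=]|[x y] [[/=]|[/=]]]; rewrite ?in_itv/=.
  - by move=> /andP[x0 xt] y01; case: (leP x b) => xs; [left|right];
      split => //=; rewrite ?in_itv/= ?x0 ?xs.
  - by move=> /andP[x0 xs] y01; split => //=; rewrite ?in_itv/= x0 (le_trans xs bc).
  - by move=> /andP[sx xt] y01; split => //=; rewrite ?in_itv/= xt (le_lt_trans ab sx).
have -> : nu (band a b d `|` band b c d) = (nu (band a b d) + nu (band b c d))%E.
  rewrite measureU; try exact: measurable_band; first by [].
  apply/seteqP; split => // -[x y] [[/= + _] [/= + _]].
  rewrite !in_itv/= => /andP[_ xb] /andP[bx _].
  by have := lt_le_trans bx xb; rewrite ltxx.
have [->|[n ->]] := nu_integer (measurable_band a b d).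
  by rewrite addye// gt_eqF// (lt_le_trans ltNy0).
have [->|[m ->]] := nu_integer (measurable_band b c d); first by rewrite addey.
rewrite -EFinD -natrD lte_fin ltr_nat; case: n => [|n]; first by left.
by case: m => [|m]; [right|rewrite addnS addSn].
Qed.

(** Up to the horizon T beta is at most b, so atom-free windows must end before T. Near x, either T
    is at distance eta in time, or the path still has to climb by eta until T, which no atom-free
    window allows. *)
Lemma upper_local_dim_le_path x b T r0 eta g g2 K :
  0 < g -> 0 < b -> g + b <= g2 ->
  sparse_points nu g 2 -> sparse_points nu g2 K -> quiet_start nu g ->
  0 < T -> T <= 1 -> (forall y, 0 < y <= T -> beta (left_limit X y) <= b) ->
  0 < r0 -> 0 < eta ->
  (forall s, 0 <= s <= 1 -> `|x - X s| < r0 ->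
    s < T /\ (s + eta <= T \/ eta <= X T - X s)) ->
  msupport (occupation_measure X) x ->
  (upper_local_dim (occupation_measure X) x <= (b / g)%:E)%E.
Proof.
move=> g0 b0 gb2 sp sp2 [n3 quiet] T0 T1 bT r00 eta0 sT xs.
have [C [C0 [n1 incr]]] := path_increment_le g0 b0 gb2 sp2.
have [n2 sparse] := sparse_points_band sp.
have gb0 : 0 < g / b by exact: divr_gt0.
have [n4 hn4] := expR_lt_near0 gb0 (divr_gt0 r00 C0).
have [n5 hn5] := expR_lt_near0 gb0 (divr_gt0 eta0 C0).
have [n6 hn6] := expR_lt_near0 ltr01 eta0.
rewrite -[b / g]invf_div.
(* The radius becomes 2 rho: one rho from x to X s, another for the oscillation of the path on the
   window around s. *)
apply: (@upper_local_dim_le _ _ _ (ln (2 * C)) _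
  (\max_(i <- [:: n1; n2; n3; n4; n5; n6]) i)%N) => //.
- exact: le_occupation_measure.
- exact: occupation_measure_lty.
move=> n /bigmax_leqP_seq nn.
have {nn}[[n1n n2n n3n] [n4n n5n n6n]] : [/\ (n1 <= n)%N, (n2 <= n)%N & (n3 <= n)%N] /\
    [/\ (n4 <= n)%N, (n5 <= n)%N & (n6 <= n)%N].
  by split; split; apply: nn => //; rewrite !inE eqxx ?orbT.
set d := expR (- n%:R); set rho := C * expR (- (g / b * n%:R)).
have d0 : 0 < d by exact: expR_gt0.
have rho0 : 0 < rho by rewrite mulr_gt0// expR_gt0.
have rho_r0 : rho < r0 by rewrite /rho mulrC -ltr_pdivlMr//; exact: hn4.
have rho_eta : rho < eta by rewrite /rho mulrC -ltr_pdivlMr//; exact: hn5.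
have d_eta : d < eta by have := hn6 n n6n; rewrite mul1r.
have -> : expR (ln (2 * C) - g / b * n%:R) = 2 * rho.
  by rewrite expRD lnK ?posrE ?mulr_gt0// mulrA.
have [s s01 xs_s] := occupation_measure_gt0 (xs rho rho0).
have [s_T sT_or] := sT s s01 (lt_trans xs_s rho_r0).
have /andP[s0 s1] := s01.
have band0 (u v u' v' : R) : u' <= u -> v <= v' ->
    nu (band u' v' (expR (- (g * n%:R)))) = 0%E -> nu (band u v (expR (- (g * n%:R)))) = 0%E.
  move=> uu vv n0; apply/eqP; rewrite eq_le measure_ge0 andbT -n0.
  by apply: le_measure; rewrite ?inE; try exact: measurable_band; exact: band_subset.
(* It suffices to find a window of length d that contains s, ends before T and has no large atom:
   the path stays 2 rho-close to x throughout it. *)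
suff [u [u0 us su uT nu0]] : exists u, [/\ 0 <= u, u <= s, s <= u + d, u + d <= T &
    nu (band u (u + d) (expR (- (g * n%:R)))) = 0%E].
  have ud : u <= u + d by lra.
  have Xinc : X (u + d) - X u <= rho.
    apply: incr => //; first exact: le_trans uT T1.
    by move=> y /andP[uy yd]; apply: bT; rewrite (le_lt_trans u0 uy) (le_trans yd uT).
  have -> : d = u + d - u by ring.
  apply: occupation_measure_ge => //; first exact: le_trans uT T1.
  move=> v /andP[uv vd] /=.
  have X1 := path_nondecreasing u0 uv (le_trans vd (le_trans uT T1)).
  have X2 := path_nondecreasing (le_trans u0 uv) vd (le_trans uT T1).
  have X3 := path_nondecreasing u0 us s1.
  have X4 := path_nondecreasing s0 su (le_trans uT T1).
  by move: xs_s; rewrite /ball/= !ltr_norml => /andP[? ?]; lra.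
(* If the window on the right of s overshot T, the path would gain at most rho < eta between s and
   T. *)
have right_case : nu (band s (s + d) (expR (- (g * n%:R)))) = 0%E ->
    exists u, [/\ 0 <= u, u <= s, s <= u + d, u + d <= T &
    nu (band u (u + d) (expR (- (g * n%:R)))) = 0%E].
  move=> nus; exists s; split => //; first by rewrite lerDl ltW.
  rewrite leNgt; apply/negP => Tsd; case: sT_or => [|etaX]; first lra.
  have nusT : nu (band s T (expR (- (g * n%:R)))) = 0%E.
    by apply: band0 nus => //; exact: ltW.
  have : X T - X s <= rho.
    apply: incr => //; [exact: ltW|exact: ltW|].
    by move=> y /andP[sy yT]; apply: bT; rewrite (le_lt_trans s0 sy) yT.
  lra.
(* With no room on the left, the quiet start provides the window on the right. *)
case: (ltP s d) => sd.
  by apply: right_case; apply: band0 (quiet n n3n) => //; rewrite -/d; lra.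
have [|||nul|/right_case//] := @band_lt2_split (s - d) s (s + d) (expR (- (g * n%:R))).
- by rewrite gerBl ltW.
- by rewrite lerDl ltW.
- by apply: sparse => //; rewrite -/d; lra.
- exists (s - d); rewrite subrK; split => //; [lra|lra|exact: ltW].
Qed.

Hypothesis beta_increasing : {homo beta : x y / x < y}.
Hypothesis nu_regular : regular_points nu.

(** Let g = 1/2 - i with i small: b / g comes within e of 2 b, and b < 1/2 leaves room for g + b <=
    1 - 2 k. *)
Lemma upper_local_dim_le_double x b T r0 eta :
  0 < b -> b < 2^-1 ->
  0 < T -> T <= 1 -> (forall y, 0 < y <= T -> beta (left_limit X y) <= b) ->
  0 < r0 -> 0 < eta ->
  (forall s, 0 <= s <= 1 -> `|x - X s| < r0 ->
    s < T /\ (s + eta <= T \/ eta <= X T - X s)) ->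
  msupport (occupation_measure X) x ->
  (upper_local_dim (occupation_measure X) x <= (2 * b)%:E)%E.
Proof.
move=> b0 b12 T0 T1 bT r00 eta0 sT xs; apply/lee_addgt0Pr => e e0; rewrite -EFinD.
have [_ sparse2 quiet sparseK] := nu_regular.
have [m [i [i0 i2 iE ie]]] : exists m, exists i : R,
    [/\ 0 < i, i < 2^-1, i = m.+3%:R^-1 & i * (2 * b + e) <= e / 2].
  pose m := Num.truncn ((2 * b + e) / (e / 2)).
  exists m, m.+3%:R^-1; split => //.
  - by rewrite ltf_pV2 ?posrE// ltr_nat.
  - rewrite ler_pdivrMl// -ler_pdivrMr ?divr_gt0//.
    by rewrite ltW// (lt_le_trans (truncnS_gt _))// ler_nat ltnW// ltnW.
have [K [k [k0 kE kb]]] : exists K, exists k : R,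
    [/\ 0 < k, k = K.+2%:R^-1 & 2 * k <= 2^-1 - b].
  pose K := Num.truncn (2 / (2^-1 - b)).
  exists K, K.+2%:R^-1; split => //.
  rewrite ler_pdivrMr// mulrC -ler_pdivrMr ?subr_gt0//.
  by rewrite ltW// (lt_le_trans (truncnS_gt _))// ler_nat.
have g0 : 0 < 2^-1 - i by lra.
apply: (@le_trans _ _ (b / (2^-1 - i))%:E); last first.
  by rewrite lee_fin ler_pdivrMr//; lra.
apply: (@upper_local_dim_le_path x b T r0 eta (2^-1 - i) (1 - 2 * k) K.+2) => //.
- lra.
- by rewrite iE; exact: sparse2.
- by rewrite kE; exact: sparseK.
- by rewrite iE; exact: quiet.
Qed.

Lemma path_strictly_increasing s t : 0 <= s -> s < t -> t <= 1 -> X s < X t.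
Proof.
apply: path_increasing; exists (1 + 1%:R^-1); split; last by have [+ _ _ _] := nu_regular; apply.
by rewrite invr1.
Qed.

(** * Local dimensions around a jump *)

Section Jump.
Variable t : R.
Hypothesis t_jump : jump_times X t.
Hypothesis beta_small : beta (left_limit X t) < 2^-1.
Local Notation L := (left_limit X t).
Local Notation mu := (occupation_measure X).

Lemma jump_time_gt0 : 0 < t. Proof. by case: t_jump => /andP[]. Qed.
Lemma jump_time_le1 : t <= 1. Proof. by case: t_jump => /andP[]. Qed.
Lemma left_limit_lt_jump : L < X t.
Proof.
have [t0 t1] := conj jump_time_gt0 jump_time_le1.
by rewrite lt_neqAle eq_sym left_limit_le_path// andbT; case: t_jump. Qed.

(** Strictness comes from a horizon T before t: there X T < L, so beta (X T) < beta L bounds the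
    relevant values of beta. *)
Lemma dim_before_jump x : msupport mu x -> x < L ->
  (upper_local_dim mu x < (2 * beta L)%:E)%E.
Proof.
have [t0 t1 L_lt] := And3 jump_time_gt0 jump_time_le1 left_limit_lt_jump.
(* Only times before s1 bring the path close to x; the midpoint T of s1 and t leaves them the room T
   - s1. *)
move=> xs xL; have [s1 /andP[s10 s1t] xs1] := left_limit_gt t0 t1 xL.
pose T := (s1 + t) / 2.
have [s1T Tt] : s1 < T /\ T < t by rewrite /T; split; lra.
have T0 : 0 < T by lra.
have T1 : T <= 1 by lra.
have XTL : X T < L.
  apply: (@lt_le_trans _ _ (X ((T + t) / 2))); last by apply: path_le_left_limit; lra.
  by apply: path_strictly_increasing; lra.
apply: (@le_lt_trans _ _ (2 * beta (X T))%:E); last first.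
  by rewrite lte_fin ltr_pM2l//; exact: beta_increasing.
apply: (@upper_local_dim_le_double x _ T (X s1 - x) (T - s1)) => //.
- exact: beta_gt0.
- by apply: lt_trans beta_small; exact: beta_increasing.
- move=> y /andP[y0 yT]; apply: beta_nondecreasing; apply: (@le_trans _ _ (X y)).
    by apply: left_limit_le_path => //; exact: le_trans yT T1.
  by apply: path_nondecreasing => //; exact: ltW.
- by rewrite subr_gt0.
- by rewrite subr_gt0.
- move=> s /andP[s0 s1'] xXs.
  suff : s < s1 by move=> ?; split; [lra|left; lra].
  rewrite ltNge; apply/negP => s1s.
  have := path_nondecreasing (ltW s10) s1s s1'.
  by move: xXs; rewrite ltr_norml => /andP[? ?]; lra.
Qed.

Lemma path_dichotomy s : 0 <= s <= 1 -> s < t /\ X s <= L \/ t <= s /\ X t <= X s.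
Proof.
have [t0 t1 L_lt] := And3 jump_time_gt0 jump_time_le1 left_limit_lt_jump.
move=> /andP[s0 s1]; case: (ltP s t) => st; [left|right]; split => //.
  exact: path_le_left_limit.
by apply: path_nondecreasing => //; exact: ltW.
Qed.

(** Here the horizon is t itself: the jump at t supplies the climb eta, and beta of the left limit
    is still at most beta L at time t. *)
Lemma dim_left_limit : msupport mu L -> (upper_local_dim mu L <= (2 * beta L)%:E)%E.
Proof.
have [t0 t1 L_lt] := And3 jump_time_gt0 jump_time_le1 left_limit_lt_jump.
move=> Ls; apply: (@upper_local_dim_le_double L _ t (X t - L) (X t - L)) => //.
- exact: beta_gt0.
- move=> y /andP[y0]; rewrite le_eqVlt => /predU1P[->//|yt].
  apply: beta_nondecreasing; apply: (@le_trans _ _ (X y)).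
    by apply: left_limit_le_path => //; exact: le_trans (ltW yt) t1.
  by apply: path_le_left_limit => //; exact: ltW.
- by rewrite subr_gt0.
- by rewrite subr_gt0.
- move=> s s01 LXs; case: (path_dichotomy s01) => -[st Xs].
    by split => //; right; lra.
  by move: LXs; rewrite ltr_norml => /andP[? ?]; lra.
Qed.

Lemma notin_support_gap x : L < x -> x < X t -> ~ msupport mu x.
Proof.
have [t0 t1 L_lt] := And3 jump_time_gt0 jump_time_le1 left_limit_lt_jump.
move=> Lx xt /(_ (Num.min (x - L) (X t - x))).
rewrite lt_min !subr_gt0 Lx xt => /(_ isT) /occupation_measure_gt0[s s01].
rewrite /ball/= lt_min !ltr_norml => /andP[/andP[? ?] /andP[? ?]].
by case: (path_dichotomy s01) => -[_ ?]; lra.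
Qed.

(** Near x the path exceeds the midpoint y of X t and x, and beta y > beta (X t) gives
    strictness. *)
Lemma dim_after_jump x : msupport mu x -> X t < x ->
  ((beta (X t))%:E < upper_local_dim mu x)%E.
Proof.
move=> xs tx; pose y := (X t + x) / 2.
have [ty yx] : X t < y /\ y < x by rewrite /y; split; lra.
apply: (@lt_le_trans _ _ (beta y)%:E).
  by rewrite lte_fin; exact: beta_increasing.
have [dn _ _ _] := nu_regular.
apply: (@upper_local_dim_ge_path x (beta y) (x - y)) => //; first exact: beta_gt0.
  by rewrite subr_gt0.
move=> s _ xXs; apply: beta_nondecreasing.
by move: xXs; rewrite ltr_norml => /andP[? ?]; lra.
Qed.

(** Within X t - L of X t the path is found only from time t on. *)
Lemma dim_jump : msupport mu (X t) -> ((beta (X t))%:E <= upper_local_dim mu (X t))%E.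
Proof.
have [t0 t1 L_lt] := And3 jump_time_gt0 jump_time_le1 left_limit_lt_jump.
have [dn _ _ _] := nu_regular => ts.
apply: (@upper_local_dim_ge_path (X t) (beta (X t)) (X t - L)) => //; first exact: beta_gt0.
  by rewrite subr_gt0.
move=> s s01; rewrite ltr_norml => /andP[? ?]; apply: beta_nondecreasing.
by case: (path_dichotomy s01) => -[_ ?]; lra.
Qed.

Lemma level_set_jump h x : 2 * beta L <= h -> h <= beta (X t) -> msupport mu x ->
  upper_local_dim mu x = h%:E -> x = L /\ h = 2 * beta L \/ x = X t /\ h = beta (X t).
Proof.
move=> Lh ht xs xh; case: (ltgtP x L) => [xL|Lx|xL].
- by have := dim_before_jump xs xL; rewrite xh lte_fin ltNge Lh.
- right; case: (ltgtP x (X t)) => [xt|tx|xt].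
  + by have := notin_support_gap Lx xt.
  + by have := dim_after_jump xs tx; rewrite xh lte_fin ltNge ht.
  + split => //; apply/eqP; rewrite eq_le ht/= -lee_fin -xh xt; apply: dim_jump.
    by rewrite -xt.
- left; split => //; apply/eqP; rewrite eq_le Lh andbT -lee_fin -xh xL.
  by apply: dim_left_limit; rewrite -xL.
Qed.

Lemma upper_spectrum_jump0 O h x : 2 * beta L <= h -> h <= beta (X t) ->
  O x -> upper_local_dim mu x = h%:E -> upper_spectrum mu O h = 0%E.
Proof.
move=> Lh ht Ox xh; apply: (@hausdorff_dim_pair _ _ L (X t)).
  (* Off the support the local dimension takes the junk value 0, and h > 0. *)
  exists x; split => //; split => //; apply: contrapT => nxs.
  have := upper_local_dim_notin_support (@le_occupation_measure _ X)
    (@occupation_measure_ge0 _ X) nxs.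
  rewrite xh => -[h0]; have := beta_gt0 L; rewrite h0 in Lh; lra.
by move=> y [[_ ys] yh]; case: (level_set_jump Lh ht ys yh) => -[-> _]; [left|right].
Qed.

(** The premises equating h with an endpoint value dismiss, in the strict cases, the end of the gap
    to which h does not belong. *)
Lemma upper_spectrum_jumpNy O h : 2 * beta L <= h -> h <= beta (X t) ->
  (O L -> h = 2 * beta L -> upper_local_dim mu L != h%:E) ->
  (O (X t) -> h = beta (X t) -> upper_local_dim mu (X t) != h%:E) ->
  upper_spectrum mu O h = -oo%E.
Proof.
move=> Lh ht hL hX; rewrite /upper_spectrum /hausdorff_dim ifT//.
apply/eqP; rewrite -subset0 => x [[Ox xs] /= xh].
case: (level_set_jump Lh ht xs xh) => -[xE hE]; rewrite xE in Ox xh.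
  by have := hL Ox hE; rewrite xh eqxx.
by have := hX Ox hE; rewrite xh eqxx.
Qed.

End Jump.

End Path.

(** * From one path to the almost sure statement *)

Lemma nowhere_constant_increasing {R : realType} (beta : R -> R) :
  nowhere_constant beta -> {homo beta : x y / x <= y} -> {homo beta : x y / x < y}.
Proof.
move=> nc nd x y xy; rewrite lt_neqAle nd ?(ltW xy)// andbT; apply/eqP => bxy.
apply: (nc x y xy); exists (beta x) => z /andP[xz zy].
by apply/eqP; rewrite eq_le {1}bxy !nd// ltW.
Qed.

Theorem theorem3 (R : realType) (d : measure_display) (Omega : measurableType d)
    (P : probability Omega R) (eps0 : R) (beta : R -> R)
    (N : R.-ker Omega ~> (R * R)%type) (M : R -> Omega -> R)
    (eps0_gt0 : 0 < eps0)
    (beta_range : forall x, eps0 <= beta x <= 1 - eps0)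
    (beta_nowhere_constant : nowhere_constant beta)
    (beta_nondecreasing : {homo beta : x y / x <= y})
    (beta_lipschitz : lipschitz beta)
    (N_poisson : poisson_random_measure P N)
    (M_stable_like : stable_like_process P beta N M) :
  {ae P, forall w,
    let X := M ^~ w in
    let mu := occupation_measure X in
    forall O : set R, open O -> is_interval O -> O !=set0 ->
    forall h : R, exceptional_values beta X h ->
    (exists2 t, jump_times X t &
      [\/ h = beta (X t) /\ 2 * beta (left_limit X t) < beta (X t),
          h = 2 * beta (left_limit X t) /\ 2 * beta (left_limit X t) < beta (X t)
        | h = beta (X t) /\ beta (X t) = 2 * beta (left_limit X t)]) /\
    forall t, jump_times X t ->
    [/\ h = beta (X t) -> 2 * beta (left_limit X t) < beta (X t) ->
          (~ O (X t) -> upper_spectrum mu O h = -oo%E) /\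
          (O (X t) ->
            (upper_local_dim mu (X t) = h%:E ->
               upper_spectrum mu O h = 0%E) /\
            ((h%:E < upper_local_dim mu (X t))%E ->
               upper_spectrum mu O h = -oo%E)),
        h = 2 * beta (left_limit X t) ->
        2 * beta (left_limit X t) < beta (X t) ->
          (~ O (left_limit X t) -> upper_spectrum mu O h = -oo%E) /\
          (O (left_limit X t) ->
            (upper_local_dim mu (left_limit X t) = h%:E ->
               upper_spectrum mu O h = 0%E) /\
            ((upper_local_dim mu (left_limit X t) < h%:E)%E ->
               upper_spectrum mu O h = -oo%E))
      & h = beta (X t) -> beta (X t) = 2 * beta (left_limit X t) ->
          [/\ O (X t) -> O (left_limit X t) ->
                (upper_local_dim mu (left_limit X t) = h%:E \/
                 upper_local_dim mu (X t) = h%:E ->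
                   upper_spectrum mu O h = 0%E) /\
                ((upper_local_dim mu (left_limit X t) < h%:E)%E ->
                 (h%:E < upper_local_dim mu (X t))%E ->
                   upper_spectrum mu O h = -oo%E),
              O (left_limit X t) -> ~ O (X t) ->
                (upper_local_dim mu (left_limit X t) = h%:E ->
                   upper_spectrum mu O h = 0%E) /\
                ((upper_local_dim mu (left_limit X t) < h%:E)%E ->
                   upper_spectrum mu O h = -oo%E),
              O (X t) -> ~ O (left_limit X t) ->
                (upper_local_dim mu (X t) = h%:E ->
                   upper_spectrum mu O h = 0%E) /\
                ((h%:E < upper_local_dim mu (X t))%E ->
                   upper_spectrum mu O h = -oo%E)
            & ~ O (X t) -> ~ O (left_limit X t) ->
                upper_spectrum mu O h = -oo%E]]}.
Proof.
have beta_increasing :=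
  nowhere_constant_increasing beta_nowhere_constant beta_nondecreasing.
case: M_stable_like => _; apply: filterS2 (ae_regular_points N_poisson) => w reg [cad Xint].
move=> O _ _ _ h hE.
have nint A (mA : measurable A) := count_integer N_poisson w mA.
pose L t := left_limit (M ^~ w) t.
(* A value of beta stays below 1, hence a double jump can only start where beta < 1/2. *)
have small t : 2 * beta (L t) <= beta (M t w) -> beta (L t) < 2^-1.
  by have /andP[_] := beta_range (M t w); lra.
have spec0 := upper_spectrum_jump0 eps0_gt0 beta_range beta_nondecreasing
  cad Xint nint beta_increasing reg.
have specNy := upper_spectrum_jumpNy eps0_gt0 beta_range beta_nondecreasing
  cad Xint nint beta_increasing reg.
have neq_lt (a b : \bar R) : (a < b)%E -> a != b by move=> ab; rewrite lt_eqF.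
have neq_gt (a b : \bar R) : (a < b)%E -> b != a by move=> ab; rewrite gt_eqF.
split.
  (* Equality leads to the third case, whichever of the two values h is; a strict inequality leads
     to the first or the second. *)
  case: hE => -[t [jt]]; rewrite le_eqVlt => /orP[/eqP e|lt] <-; exists t => //.
  - by apply: Or33.
  - by apply: Or31.
  - by apply: Or33; split => //; rewrite e.
  - by apply: Or32.
move=> t jt; split=> hX.
- move=> lt; have sm := small t (ltW lt).
  have le1 : 2 * beta (L t) <= h by rewrite hX ltW.
  have le2 : h <= beta (M t w) by rewrite hX.
  (* Strictness excludes the left limit, so only X t can carry the level h. *)
  have hL : h <> 2 * beta (L t) by move=> e; move: lt; rewrite -hX e ltxx.
  split=> [nO|OX]; last split=> [e|gt].
  + exact: (specNy t jt sm O h le1 le2).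
  + exact: (spec0 t jt sm O h _ le1 le2 OX e).
  + by apply: (specNy t jt sm O h le1 le2) => // _ _; exact: neq_gt.
- move=> lt; have sm := small t (ltW lt).
  have le1 : 2 * beta (L t) <= h by rewrite hX.
  have le2 : h <= beta (M t w) by rewrite hX ltW.
  have hM : h <> beta (M t w) by move=> e; move: lt; rewrite -hX e ltxx.
  split=> [nO|OL]; last split=> [e|gt].
  + exact: (specNy t jt sm O h le1 le2).
  + exact: (spec0 t jt sm O h _ le1 le2 OL e).
  + by apply: (specNy t jt sm O h le1 le2) => // _ _; exact: neq_lt.
- move=> eX; have sm : beta (L t) < 2^-1 by apply: small; rewrite eX.
  have le1 : 2 * beta (L t) <= h by rewrite hX eX.
  have le2 : h <= beta (M t w) by rewrite hX.
  have s0 := spec0 t jt sm O h _ le1 le2.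
  have sNy := specNy t jt sm O h le1 le2.
  split.
  + move=> OX OL; split=> [[e|e]|e1 e2]; [exact: s0 OL e|exact: s0 OX e|].
    by apply: sNy => _ _; [exact: neq_lt|exact: neq_gt].
  + move=> OL nOX; split=> [e|e]; first exact: s0 OL e.
    by apply: sNy => // _ _; exact: neq_lt.
  + move=> OX nOL; split=> [e|e]; first exact: s0 OX e.
    by apply: sNy => // _ _; exact: neq_gt.
  + by move=> nOX nOL; apply: sNy.
Qed.
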